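(* In the Gaussian sequence model $Y_j=\theta_j^0+\frac1{\sqrt n}\xi_j$, $j\ge1$, let $\alpha>1/2$ and suppose that $\theta^0\neq0$ belongs to the Sobolev class of regularity $\alpha$, i.e. $\sum_{j=1}^\infty|\theta_j^0|^2j^{2\alpha}<\infty$. Choose a prior $\widetilde W=\mathcal{N}(0,\tau_n^2I_{k_n})$ on $\theta\in\mathbb{R}^{k_n}$ with $\tau_n>0$ such that $n^{-1/4}=o(\tau_n)$. Then, for any choice of $k_n$ such that $k_n=o(\sqrt n)$ and $\sqrt n=o(k_n^{2\alpha})$, $$E\left[\sup_{I\in\mathcal{I}}\left|\widetilde W\left(\frac{\sqrt n\left(\|\theta\|^2-\|\theta_Y\|^2\right)}{2\|\theta^0\|}\in I\ \Big|\ Y\right)-\psi(I)\right|\right]\longrightarrow0\qquad\text{as }n\to\infty$$ and $$\frac{\sqrt n\left(\|\theta_Y\|^2-\|\theta_0\|^2\right)}{2\|\theta^0\|}\longrightarrow\mathcal{N}(0,1)\quad\text{in distribution, as }n\to\infty .$$ Further, the bias is negligible with respect to the square root of the variance: $$\frac{\sqrt n\left(\|\theta_0\|^2-\|\theta^0\|^2\right)}{2\|\theta^0\|}=o(1).$$ In particular, the choice $k_n=\lfloor\sqrt{n/\ln n}\rfloor$ is adaptive in $\alpha$: it satisfies the two growth conditions $k_n=o(\sqrt n)$ and $\sqrt n=o(k_n^{2\alpha})$ for every $\alpha>1/2$, so that, for every $\alpha>1/2$, with this choice of $k_n$ the posterior distribution of $\sqrt n\left(\|\theta\|^2-\|\theta_Y\|^2\right)/(2\|\theta^0\|)$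 satisfies $E\left[\sup_{I\in\mathcal{I}}\left|\widetilde W\left(\frac{\sqrt n\left(\|\theta\|^2-\|\theta_Y\|^2\right)}{2\|\theta^0\|}\in I\ \Big|\ Y\right)-\psi(I)\right|\right]\to0$, the variable $\sqrt n\left(\|\theta_Y\|^2-\|\theta_0\|^2\right)/(2\|\theta^0\|)$ converges in distribution to $\mathcal{N}(0,1)$, and $\sqrt n\left(\|\theta_0\|^2-\|\theta^0\|^2\right)/(2\|\theta^0\|)=o(1)$.
   Context: Gaussian sequence model: for each $n\ge1$ one observes $Y_j=\theta_j^0+n^{-1/2}\xi_j$, $j\ge1$, where $\xi_1,\xi_2,\dots$ are independent $\mathcal{N}(0,1)$ and $\theta^0=(\theta^0_j)_{j\ge1}$ is the true parameter, not depending on $n$; $E$ is expectation under this true distribution. For integers $1\le k_n\le n$ one uses the first $k_n$ coordinates: $\theta_0=(\theta_j^0)_{1\le j\le k_n}$ and $\theta_Y=(Y_j)_{1\le j\le k_n}$. $\widetilde W(\cdot\mid Y)$ is the posterior distribution of $\theta\in\mathbb{R}^{k_n}$ when $\theta\sim\widetilde W$ and, conditionally on $\theta$, $(Y_j)_{1\le j\le k_n}\sim\mathcal{N}(\theta,\frac1nI_{k_n})$. $\|\cdot\|$ is the Euclidean (or $\ell^2$) norm. $\mathcal{I}$ is the collection of all intervals of $\mathbb{R}$ and $\psi(I)=P(Z\in I)$ with $Z\sim\mathcal{N}(0,1)$. *)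

(* Defs.v *)
From HB Require Import structures.
From mathcomp Require Export all_boot all_order all_algebra.
From mathcomp Require Export all_classical all_reals all_analysis.

Export numFieldNormedType.Exports.
Import Order.TTheory GRing.Theory Num.Theory.

Set Implicit Arguments.
Unset Strict Implicit.
Unset Printing Implicit Defensive.

Local Open Scope classical_set_scope.
Local Open Scope ring_scope.

Section product_power.
Context d (T : measurableType d) (R : realType).

Definition cons_pair k (x : T * k.-tuple T) : k.+1.-tuple T :=
  [tuple of x.1 :: x.2].

Lemma measurable_cons_pair k : measurable_fun [set: T * k.-tuple T] (@cons_pair k).
Proof. exact: (measurable_cons measurable_fst measurable_snd). Qed.

HB.instance Definition _ k :=
  isMeasurableFun.Build _ _ _ _ (@cons_pair k) (@measurable_cons_pair k).

(* The k-fold product mu \x ... \x mu, transported to k-tuples. *)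
Fixpoint prob_power (mu : probability T R) k : probability (k.-tuple T) R :=
  match k with
  | 0 => dirac [tuple]
  | k'.+1 => distribution (mu \x prob_power mu k')%E
               [the {mfun _ >-> _} of @cons_pair k']
  end.

End product_power.

Section probability_notions.
Context d (Omega : measurableType d) (R : realType) (P : probability Omega R).

Definition mutually_independent (X : nat -> {RV P >-> R}) :=
  forall (J : seq nat), uniq J ->
  forall B : nat -> set R, (forall j, measurable (B j)) ->
  P (\bigcap_(j in [set` J]) (X j @^-1` B j)) =
  (\prod_(j <- J) P (X j @^-1` B j))%E.

(* Convergence of distribution functions at continuity points of the limit. *)
Definition cvg_in_distribution (X : nat -> Omega -> R)
    (mu : set R -> \bar R) :=
  forall x : R, {for x, continuous (fun r => mu `]-oo, r]%classic)} ->
  P [set w | X n w <= x] @[n --> \oo] --> mu `]-oo, x]%classic.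

End probability_notions.

(* Bayes' formula, for a prior on the parameter and a likelihood (the density
   of the observation given the parameter, evaluated at the observed value). *)
Definition posterior d (T : measurableType d) (R : realType)
    (prior : probability T R) (lik : T -> R) (A : set T) : R :=
  (\int[prior]_(t in A) lik t) / (\int[prior]_t lik t).

(* [interval R] comprises all intervals, of any kind, bounded or not. *)
Definition interval_dist (R : realType) (f : set R -> R) (g : set R -> \bar R) :=
  ereal_sup [set `|(f [set` I])%:E - g [set` I]|%E | I in [set: interval R]].

Section gaussian_sequence_model.
Context (R : realType).

Definition euclid_norm k (t : k.-tuple R) : R :=
  Num.sqrt (\sum_(j < k) tnth t j ^+ 2).

(* Only meaningful when [u] is square-summable. *)
Definition l2_norm (u : nat -> R) : R :=
  Num.sqrt (limn [series u j ^+ 2]_j).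

Definition first_coords k (u : nat -> R) : k.-tuple R := [tuple u j | j < k].

(* Sequences are indexed from 0: [u j] is the coordinate of index j + 1. *)
Definition sobolev (alpha : R) (u : nat -> R) :=
  cvgn [series `|u j| ^+ 2 * (j.+1)%:R `^ (2 * alpha)]_j.

Definition obs (theta0 : nat -> R) (n : nat) (xi : nat -> R) (j : nat) : R :=
  theta0 j + (Num.sqrt n%:R)^-1 * xi j.

(* [normal_prob] and [normal_pdf] take the standard deviation. *)
Definition gaussian_prior (tau : R) k : probability (k.-tuple (measurableTypeR R)) R :=
  prob_power (normal_prob 0 tau) k.

(* Lebesgue density at [y] of N(t, n^-1 I_k). *)
Definition likelihood k (n : nat) (y t : k.-tuple R) : R :=
  \prod_(j < k) normal_pdf (tnth t j) (Num.sqrt n%:R)^-1 (tnth y j).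

Definition scaled_sq_diff (theta0 : nat -> R) (n : nat) (a b : R) : R :=
  Num.sqrt n%:R * (a ^+ 2 - b ^+ 2) / (2 * l2_norm theta0).

Definition bvm_error (theta0 : nat -> R) (tau : R) k n (xi : nat -> R) :=
  let Y := first_coords k (obs theta0 n xi) in
  interval_dist
    (fun I => posterior (gaussian_prior tau k) (likelihood n Y)
       [set t | scaled_sq_diff theta0 n (euclid_norm t) (euclid_norm Y) \in I])
    (normal_prob 0 1).

Definition bvm_fluctuation (theta0 : nat -> R) k n (xi : nat -> R) : R :=
  scaled_sq_diff theta0 n (euclid_norm (first_coords k (obs theta0 n xi)))
    (euclid_norm (first_coords k theta0)).

Definition bvm_bias (theta0 : nat -> R) k n : R :=
  scaled_sq_diff theta0 n (euclid_norm (first_coords k theta0))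
    (l2_norm theta0).

(* The value at n = 1, where ln n = 0, is 0 by the convention x / 0 = 0. *)
Definition adaptive_dim (n : nat) : nat :=
  Num.truncn (Num.sqrt (n%:R / ln n%:R : R)).

End gaussian_sequence_model.

(* Main.v *)
From HB Require Import structures.
Require Import Defs.
From mathcomp Require Import measurable_realfun.
From mathcomp Require Import ring lra.
Import Order.TTheory GRing.Theory Num.Theory.

Set Implicit Arguments.
Unset Strict Implicit.
Unset Printing Implicit Defensive.

Local Open Scope classical_set_scope.
Local Open Scope ring_scope.

(* Put s = n^(-1/2), r^2 = tau^2 / (tau^2 + s^2) and l = ||theta^0||.  By conjugacy
   the posterior is the law of the vector (r^2 Y_j + r s Z_j)_j with Z standard Gaussian, so

     sqrt n (||theta||^2 - ||Y||^2) / (2 l) = a + b G + c ||Z||^2,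

   where G = <Y, Z> / ||Y|| is N(0, 1), a = - sqrt n (1 - r^4) ||Y||^2 / (2 l),
   b = r^3 ||Y|| / l and c = r^2 s / (2 l).  If |W - G| <= D with G standard normal,
   then W lies in an interval I and G does not (or conversely) only if D >= delta or
   G is delta-close to an endpoint of I; hence the two laws differ on I by at most
   E D / delta + 4 delta, whatever I.  Here E D <= |a| + 7 |b - 1| + 6 c k, which tends
   to 0 because sqrt n (1 - r^2) <= s / tau^2, k s and the tail l^2 - ||theta_0||^2
   do; as a function of the noise it is bounded by an affine function of
   sum_j xi_j^2, whose expectation is at most 6 k.  The fluctuation of ||theta_Y||^2 is the
   same quadratic form with r = 1 and theta_0 in place of Y. *)

(** No central limit theorem is involved: G is exactly normal, and W - G is small in mean. The
    coupling costs one Markov inequality and the boundedness of the normal density, and is uniform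
    over intervals at once. The term c ||Z||^2 is not centred, so its mean, of order k s, must
    itself vanish: this is k_n = o(sqrt n). The prior enters through s / tau^2 -> 0, which restates
    n^(-1/4) = o(tau_n), and the tail through the Sobolev condition with sqrt n = o(k_n^(2 alpha)).
    The integrands are nonnegative, so Tonelli's theorem applies without integrability
    conditions. *)

Local Notation gauss m s := (normal_prob m s : probability (measurableTypeR _) _).

(* The inferred measure structure on [pushforward] leaves the measurability proof
   unresolved, so it is given explicitly. *)
Local Notation image_measure :=
  measure_function_pushforward__canonical__measure_function_Measure.

(** * Normal integrals *)

Lemma integral_probability_cst d (T : measurableType d) (R : realType)
  (mu : probability T R) (c : \bar R) : (\int[mu]_x c = c)%E.
Proof. by rewrite integral_cst//= probability_setT mule1. Qed.

Section normal_integral.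
Context {R : realType}.
Implicit Types (f : measurableTypeR R -> \bar R) (m s a b x y : R).
Local Notation mu := (@lebesgue_measure R).

(** Change of variables holds for the Radon-Nikodym derivative, which agrees almost everywhere with
    [normal_pdf] because both have the same integral over every measurable set. *)
Lemma ge0_integral_normal_prob m s f :
  measurable_fun setT f -> (forall x, 0 <= f x)%E ->
  (\int[gauss m s]_x f x = \int[mu]_x (f x * (normal_pdf m s x)%:E))%E.
Proof.
move=> mf f0; pose nu : probability (measurableTypeR R) R := normal_prob m s.
have numu : (nu `<< mu)%E by exact: normal_prob_dominates.
rewrite -(@Radon_Nikodym_SigmaFinite.change_of_variables _ _ _ nu mu numu f setT)//.
apply: ae_eq_integral => //.
- apply: emeasurable_funM => //.
  exact: measurable_int (Radon_Nikodym_SigmaFinite.f_integrable numu).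
- apply: emeasurable_funM => //; apply/measurable_EFinP.
  exact: measurable_normal_pdf.
- apply: ae_eqe_mul2l; apply: integral_ae_eq => //.
  + exact: Radon_Nikodym_SigmaFinite.f_integrable.
  + by apply/measurable_EFinP; exact: measurable_normal_pdf.
  + by move=> A _ mA; rewrite -Radon_Nikodym_SigmaFinite.f_integral.
Qed.

(** By uniqueness of Lebesgue measure it suffices to compare both sides on half-open intervals,
    whose preimages have their length divided by [|a|]. *)
Lemma lebesgue_measure_affine (a m : R) (A : set R) : a != 0 -> measurable A ->
  mu A = (`|a|%:E * pushforward mu
     ((fun x => a * x + m)%R : measurableTypeR R -> measurableTypeR R) A)%E.
Proof.
move=> a0 mA.
have mphi : measurable_fun setT
    ((fun x => a * x + m)%R : measurableTypeR R -> measurableTypeR R).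
  by apply: measurable_funD => //; exact: measurable_funM.
pose phi (x : measurableTypeR R) : measurableTypeR R := a * x + m.
pose nu := mscale (NngNum (normr_ge0 a)) (image_measure mu mphi).
have -> : (`|a|%:E * pushforward mu phi A)%E = nu A by [].
apply: lebesgue_measure_unique => // _ [[x y] _ <-].
rewrite /nu /= /mscale /= /pushforward /= lebesgue_measure_itv/= lte_fin.
have [a_lt0|a_gt0|aE] := ltgtP a 0; last by rewrite aE eqxx in a0.
(* A negative slope reverses the order, so the preimage is closed on the left and open on the
   right. *)
- rewrite (_ : _ @^-1` _ = `[(y - m) / a, (x - m) / a[%classic).
    rewrite lebesgue_measure_itv/= lte_fin ltr_nM2r ?invr_lt0// ltrD2r.
    case: ifPn => xy; last by rewrite mule0.
    by rewrite -!EFinB -EFinM; congr EFin; rewrite ltr0_norm//; field.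
  apply/seteqP; split => z /=; rewrite !in_itv/= => /andP[h1 h2]; apply/andP; split.
  + by rewrite ler_ndivrMr// lerBrDr mulrC.
  + by rewrite ltr_ndivlMr// ltrBlDr mulrC.
  + by rewrite ltr_ndivlMr// ltrBlDr mulrC in h2.
  + by rewrite ler_ndivrMr// lerBrDr mulrC in h1.
- rewrite (_ : _ @^-1` _ = `](x - m) / a, (y - m) / a]%classic).
    rewrite lebesgue_measure_itv/= lte_fin ltr_pM2r ?invr_gt0// ltrD2r.
    case: ifPn => xy; last by rewrite mule0.
    by rewrite -!EFinB -EFinM; congr EFin; rewrite gtr0_norm//; field.
  apply/seteqP; split => z /=; rewrite !in_itv/= => /andP[h1 h2]; apply/andP; split.
  + by rewrite ltr_pdivrMr// ltrBlDr mulrC.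
  + by rewrite ler_pdivlMr// lerBrDr mulrC.
  + by rewrite ltr_pdivrMr// ltrBlDr mulrC in h1.
  + by rewrite ler_pdivlMr// lerBrDr mulrC in h2.
Qed.

Lemma ge0_integral_lebesgue_affine (a m : R) f : a != 0 ->
  measurable_fun setT f -> (forall x, 0 <= f x)%E ->
  (\int[mu]_x f x = `|a|%:E * \int[mu]_x f (a * x + m)%R)%E.
Proof.
move=> a0 mf f0.
have mphi : measurable_fun setT
    ((fun x => a * x + m)%R : measurableTypeR R -> measurableTypeR R).
  by apply: measurable_funD => //; exact: measurable_funM.
pose phi (x : measurableTypeR R) : measurableTypeR R := a * x + m.
pose nu := mscale (NngNum (normr_ge0 a)) (image_measure mu mphi).
rewrite (@eq_measure_integral _ _ _ _ nu); last first.
  by move=> A mA _; exact: lebesgue_measure_affine.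
rewrite ge0_integral_mscale//=; congr (_ * _)%E.
by rewrite ge0_integral_pushforward.
Qed.

Lemma normal_pdf_affine a m x : a != 0 ->
  normal_pdf 0 1 x = `|a| * normal_pdf m `|a| (a * x + m).
Proof.
move=> a0; rewrite !normal_pdfE ?normr_eq0 ?oner_eq0// /normal_peak /normal_fun.
rewrite real_normK ?num_real// expr1n mul1r subr0 addrK.
rewrite -[a ^+ 2 * pi *+ 2]mulrnAr sqrtrM ?sqr_ge0// sqrtr_sqr invfM mulrA.
rewrite mulrA mulfV ?normr_eq0// mul1r; congr (_ * expR _).
by field.
Qed.

Lemma ge0_integral_normal_affine a m f : a != 0 ->
  measurable_fun setT f -> (forall x, 0 <= f x)%E ->
  (\int[gauss 0 1]_x f (a * x + m)%R = \int[gauss m `|a|]_x f x)%E.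
Proof.
move=> a0 mf f0.
have mphi : measurable_fun setT
    ((fun x => a * x + m)%R : measurableTypeR R -> measurableTypeR R).
  by apply: measurable_funD => //; exact: measurable_funM.
rewrite [LHS]ge0_integral_normal_prob//; last exact: (measurableT_comp mf mphi).
rewrite (@ge0_integral_normal_prob m `|a| f mf f0).
rewrite [RHS](@ge0_integral_lebesgue_affine a m)//.
- rewrite -ge0_integralZl//.
  + apply: eq_integral => x _; rewrite muleCA -EFinM.
    by rewrite -normal_pdf_affine.
  + apply: emeasurable_funM; first exact: (measurableT_comp mf mphi).
    apply/measurable_EFinP.
    exact: (measurableT_comp (measurable_normal_pdf _ _) mphi).
  + by move=> x _; rewrite mule_ge0// lee_fin normal_pdf_ge0.
- apply: emeasurable_funM => //; apply/measurable_EFinP.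
  exact: measurable_normal_pdf.
- by move=> x; rewrite mule_ge0// lee_fin normal_pdf_ge0.
Qed.

Lemma ge0_integral_normal_scale a f : a != 0 ->
  measurable_fun setT f -> (forall x, 0 <= f x)%E ->
  (\int[gauss 0 1]_x f (a * x)%R = \int[gauss 0%R `|a|]_x f x)%E.
Proof.
move=> a0 mf f0; have E := ge0_integral_normal_affine 0 a0 mf f0.
by apply: etrans E; apply: eq_integral => y _; rewrite addr0.
Qed.

(** The density depends on mean and argument only through the square of their difference, so the two
    may be exchanged. *)
Lemma measurable_normal_pdf_mean s y : s != 0 ->
  measurable_fun setT (fun m : measurableTypeR R => (normal_pdf m s y)%:E).
Proof.
move=> s0; apply/measurable_EFinP.
rewrite (_ : (fun m => normal_pdf m s y) = normal_pdf y s).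
  exact: measurable_normal_pdf.
by apply/funext => m; rewrite !normal_pdfE// /normal_fun -opprB sqrrN.
Qed.

(* Completing the square in [t]: joint density = marginal of [y] * conditional of [t]. *)
Lemma normal_pdf_bayes (b tau s t y : R) (c := Num.sqrt (b ^+ 2 * tau ^+ 2 + s ^+ 2)) :
  0 < tau -> 0 < s ->
  normal_pdf 0 tau t * normal_pdf (b * t) s y =
  normal_pdf 0 c y * normal_pdf (b * tau ^+ 2 * y / c ^+ 2) (tau * s / c) t.
Proof.
move=> tau0 s0.
have c2_gt0 : 0 < b ^+ 2 * tau ^+ 2 + s ^+ 2.
  by rewrite -exprMn ltr_wpDl ?sqr_ge0 ?exprn_gt0.
have c2 : c ^+ 2 = b ^+ 2 * tau ^+ 2 + s ^+ 2 by rewrite sqr_sqrtr// ltW.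
have c0 : 0 < c by rewrite sqrtr_gt0.
rewrite !normal_pdfE ?gt_eqF ?divr_gt0 ?mulr_gt0//.
have peakE (u : R) : 0 < u -> normal_peak u = u^-1 * (Num.sqrt (pi *+ 2))^-1.
  move=> u0; rewrite /normal_peak -mulrnAr sqrtrM ?sqr_ge0// sqrtr_sqr.
  by rewrite gtr0_norm// invfM.
rewrite !peakE ?divr_gt0 ?mulr_gt0// /normal_fun.
rewrite mulrACA -expRD [RHS]mulrACA -expRD; congr (_ * expR _).
  by field; rewrite !gt_eqF// sqrtr_gt0 pmulrn_lgt0// pi_gt0.
rewrite !exprMn !exprVn c2 !subr0.
by field; rewrite exprMn !gt_eqF.
Qed.


(** Bayes' formula for one coordinate: [normal_pdf 0 c y] is the marginal density of [y], and the
    posterior of [t] is written as an affine image of a standard normal variable. *)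
Lemma integral_normal_bayes tau s y f (c := Num.sqrt (tau ^+ 2 + s ^+ 2)) :
  0 < tau -> 0 < s -> measurable_fun setT f -> (forall x, 0 <= f x)%E ->
  (\int[gauss 0%R tau]_t (f t * (normal_pdf t s y)%:E) =
   (normal_pdf 0 c y)%:E *
     \int[gauss 0 1]_z f ((tau * s / c) * z + tau ^+ 2 * y / c ^+ 2)%R)%E.
Proof.
move=> tau0 s0 mf f0.
have c0 : 0 < c.
  by rewrite sqrtr_gt0 ltr_wpDl ?sqr_ge0 ?exprn_gt0.
have mpdf := measurable_normal_pdf_mean y (lt0r_neq0 s0).
have u0 : 0 < tau * s / c by rewrite divr_gt0 ?mulr_gt0.
rewrite [LHS]ge0_integral_normal_prob; first last.
  by move=> x; rewrite mule_ge0// lee_fin normal_pdf_ge0.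
  exact: emeasurable_funM.
rewrite (@ge0_integral_normal_affine (tau * s / c) (tau ^+ 2 * y / c ^+ 2) f)//;
  last by rewrite gt_eqF.
rewrite gtr0_norm//.
rewrite (@ge0_integral_normal_prob (tau ^+ 2 * y / c ^+ 2) (tau * s / c) f mf f0).
set m := tau ^+ 2 * y / c ^+ 2; set v := tau * s / c.
have mfv : measurable_fun setT (fun t => f t * (normal_pdf m v t)%:E)%E.
  by apply: emeasurable_funM => //; apply/measurable_EFinP; exact: measurable_normal_pdf.
have mfv0 t : setT t -> (0 <= f t * (normal_pdf m v t)%:E)%E.
  by move=> _; rewrite mule_ge0// lee_fin normal_pdf_ge0.
have k0 : (0 <= (normal_pdf 0 c y)%:E)%E by rewrite lee_fin normal_pdf_ge0.
rewrite -(ge0_integralZl mu measurableT mfv mfv0 k0).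
apply: eq_integral => t _; rewrite -muleA [RHS]muleCA -!EFinM.
have := @normal_pdf_bayes 1 tau s t y tau0 s0.
by rewrite !expr1n !mul1r => <-; rewrite mulrC.
Qed.

(** For fixed [y], the variable z = a x + b y has density N(b y, a^2). After exchanging the
    integrals, [y] is integrated out by the same completion of the square as in Bayes' formula. *)
Lemma integral_normal_convolution a b f :
  measurable_fun setT f -> (forall x, 0 <= f x)%E ->
  (\int[gauss 0 1]_x \int[gauss 0 1]_y f (a * x + b * y)%R =
   \int[gauss 0 1]_z f (Num.sqrt (a ^+ 2 + b ^+ 2) * z)%R)%E.
Proof.
move=> mf f0; pose T := measurableTypeR R.
(* The case [a = 0] is apart because [z] then has no density given [y]. *)
have [->|a0] := eqVneq a 0.
  rewrite expr0n add0r sqrtr_sqr.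
  under eq_integral do under eq_integral do rewrite mul0r add0r.
rewrite (integral_probability_cst (gauss 0 1)).
  have [->|b0] := eqVneq b 0.
    by rewrite normr0; apply: eq_integral => x _; rewrite !mul0r.
  have scale g g0 := @ge0_integral_normal_scale g f g0 mf f0.
  have nb0 : `|b| != 0 by rewrite normr_eq0.
  by have := scale _ nb0; rewrite normr_id => ->; exact: scale.
set c := Num.sqrt _.
have c0 : 0 < c.
  by rewrite sqrtr_gt0 ltr_wpDr ?sqr_ge0// exprn_even_gt0.
have na0 : 0 < `|a| by rewrite normr_gt0.
have mN (u v : R) : measurable_fun setT (fun z : T => (normal_pdf u v z)%:E).
  by apply/measurable_EFinP; exact: measurable_normal_pdf.
have N0 (u v z : R) : (0 <= (normal_pdf u v z)%:E)%E.
  by rewrite lee_fin normal_pdf_ge0.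
have mjoint : measurable_fun setT
    (fun xz : T * T => (normal_pdf (b * xz.1) `|a| xz.2)%:E : \bar R).
  apply/measurable_EFinP.
  have -> : (fun xz : T * T => normal_pdf (b * xz.1) `|a| xz.2) =
      normal_pdf 0 `|a| \o (fun xz : T * T => xz.2 - b * xz.1).
    apply/funext => xz /=; rewrite !normal_pdfE ?gt_eqF// /normal_fun.
    by rewrite subr0.
  apply: measurableT_comp; first exact: measurable_normal_pdf.
  apply: measurable_funB => //; exact: measurable_funM.
rewrite (fubini_tonelli (fun xy : T * T => f (a * xy.1 + b * xy.2))); last 2 first.
- apply: (measurableT_comp mf); apply: measurable_funD; exact: measurable_funM.
- by move=> z; exact: f0.
under eq_integral => y _.
  rewrite (ge0_integral_normal_affine (b * y) a0 mf f0).
  rewrite (ge0_integral_normal_prob (b * y) `|a| mf f0).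
  over.
rewrite /= (fubini_tonelli (fun yz : T * T =>
  f yz.2 * (normal_pdf (b * yz.1) `|a| yz.2)%:E)%E); last 2 first.
- apply: emeasurable_funM => //; exact: measurableT_comp mf measurable_snd.
- by move=> yz /=; rewrite mule_ge0.
transitivity (\int[gauss 0 c]_z f z)%E; last first.
  have E := @ge0_integral_normal_scale c f (lt0r_neq0 c0) mf f0.
  by apply: esym; rewrite gtr0_norm in E.
transitivity (\int[mu]_z (f z * (normal_pdf 0 c z)%:E))%E; last first.
  exact: esym (@ge0_integral_normal_prob 0 c f mf f0).
apply: eq_integral => z _.
(* Here [y] acts as the parameter, with prior N(0, 1), and [z] as the observation; the conditional
   density of [y] then integrates to 1. *)
have bayes (y : R) : (f z * (normal_pdf (b * y) `|a| z)%:E * (normal_pdf 0 1 y)%:E =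
    (f z * (normal_pdf 0 c z)%:E) *
      (normal_pdf (b * z / c ^+ 2) (`|a| / c) y)%:E)%E.
  rewrite -!muleA -!EFinM; congr (_ * _%:E)%E.
  have := @normal_pdf_bayes b 1 `|a| y z ltr01 na0.
  rewrite !expr1n !mulr1 real_normK ?num_real// [b ^+ 2 + _]addrC mul1r => <-.
  by rewrite mulrC.
rewrite [LHS]ge0_integral_normal_prob.
- under eq_integral do rewrite bayes.
  rewrite ge0_integralZl//; last by rewrite mule_ge0.
  by rewrite integral_normal_pdf mule1.
- apply: emeasurable_funM; first exact: (measurable_cst (f z)).
  exact: (measurableT_comp mjoint (pair2_measurable z)).
- by move=> y; rewrite mule_ge0.
Qed.

End normal_integral.

(** * Gaussian vectors *)

(** Peels off the first coordinate, which drives the inductions on the dimension below. *)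
Lemma ge0_integral_prob_power d (T : measurableType d) (R : realType)
    (mu : probability T R) k (f : k.+1.-tuple T -> \bar R) :
  measurable_fun setT f -> (forall t, 0 <= f t)%E ->
  (\int[prob_power mu k.+1]_t f t =
   \int[mu]_x \int[prob_power mu k]_t f (cons_pair (x, t)))%E.
Proof.
move=> mf f0; have mc := @measurable_cons_pair _ T k.
transitivity (\int[(mu \x prob_power mu k)%E]_xt f (cons_pair xt))%E.
  exact: ge0_integral_distribution.
apply: (fubini_tonelli1 (f \o @cons_pair _ T k)) => [|xt].
  exact: (measurableT_comp mf mc).
exact: f0.
Qed.

Section standard_gaussian_vector.
Context {R : realType}.
Local Notation V k := (k.-tuple (measurableTypeR R)).
Local Notation gauss_vec k := (prob_power (gauss (0:R) 1) k).

Lemma measurable_cons_pair_snd d (T : measurableType d) k (x : T) :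
  measurable_fun setT (fun t : k.-tuple T => cons_pair (x, t)).
Proof. exact: (measurableT_comp (@measurable_cons_pair _ T k) (pair1_measurable x)). Qed.

Lemma measurable_tuple_affine k (u v : R) (y : V k) :
  measurable_fun setT
    (fun z : V k => [tuple u * tnth z j + v * tnth y j | j < k] : V k).
Proof.
apply/measurable_fun_tnthP => j; apply: eq_measurable_fun.
  by move=> z _; rewrite /= tnth_mktuple.
apply: measurable_funD => //; apply: measurable_funM => //.
exact: measurable_tnth.
Qed.

Lemma tuple_affine_cons k (u v x y0 : R) (z y : V k) :
  [tuple u * tnth (cons_pair (x, z)) j + v * tnth [tuple of y0 :: y] j | j < k.+1]
  = cons_pair (u * x + v * y0, [tuple u * tnth z j + v * tnth y j | j < k]).
Proof.
apply: eq_from_tnth => j; rewrite tnth_mktuple /cons_pair.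
case: (unliftP ord0 j) => [i|] ->; rewrite ?tnthS ?tnth0//=.
by rewrite tnth_mktuple.
Qed.

(** Prior and likelihood are both products, so the one-dimensional formula applies coordinate by
    coordinate. The function [f] is arbitrary because the induction hypothesis is used on its
    sections. *)
Lemma integral_prob_power_bayes k (tau s : R) (y : V k) (f : V k -> \bar R)
    (c := Num.sqrt (tau ^+ 2 + s ^+ 2)) :
  0 < tau -> 0 < s -> measurable_fun setT f -> (forall t, 0 <= f t)%E ->
  (\int[prob_power (gauss 0%R tau) k]_t
      (f t * (\prod_(j < k) normal_pdf (tnth t j) s (tnth y j))%:E) =
   (\prod_(j < k) normal_pdf 0 c (tnth y j))%:E *
   \int[gauss_vec k]_z
      f [tuple tau * s / c * tnth z j + tau ^+ 2 / c ^+ 2 * tnth y j | j < k]%R)%E.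
Proof.
move=> tau0 s0; elim: k y f => [|k IH] y f mf f0.
  rewrite big_ord0 mul1e; apply: eq_integral => t _.
  rewrite big_ord0 mule1 (tuple0 t).
  by congr f; exact/esym/tuple0.
case/tupleP: y => y0 y.
have pdf_ge0 (x v : R) : (0 <= (normal_pdf x s v)%:E)%E.
  by rewrite lee_fin normal_pdf_ge0.
have mpdf_s (v : R) := measurable_normal_pdf_mean v (lt0r_neq0 s0).
have mprod j (w : V j) : measurable_fun setT
    (fun t : V j => (\prod_(i < j) normal_pdf (tnth t i) s (tnth w i))%:E).
  apply/measurable_EFinP; apply: measurable_prod => i _.
  have /measurable_EFinP mi := mpdf_s (tnth w i).
  exact: (measurableT_comp mi (@measurable_tnth _ _ _ i)).
have prod_ge0 j (w t : V j) :
    (0 <= (\prod_(i < j) normal_pdf (tnth t i) s (tnth w i))%:E)%E.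
  by rewrite lee_fin prodr_ge0// => i _; exact: normal_pdf_ge0.
have mf1 (x : measurableTypeR R) : measurable_fun setT (fun t : V k => f (cons_pair (x, t))).
  exact: (measurableT_comp mf (measurable_cons_pair_snd x)).
pose post (z : V k) : V k :=
  [tuple tau * s / c * tnth z j + tau ^+ 2 / c ^+ 2 * tnth y j | j < k].
have mpost : measurable_fun setT post by exact: measurable_tuple_affine.
(* The integral of [f] under the posterior of the last [k] coordinates, the first being fixed at
   [x]; the one-dimensional formula is then applied to [g]. *)
pose g (x : measurableTypeR R) := (\int[gauss_vec k]_z f (cons_pair (x, post z)))%E.
have mg : measurable_fun setT g.
  apply: (@measurable_fun_fubini_tonelli_F _ _ (measurableTypeR R) (V k) R (gauss_vec k)
    (fun xz : measurableTypeR R * V k => f (cons_pair (xz.1, post xz.2)))).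
    apply: (measurableT_comp mf
      (measurableT_comp (@measurable_cons_pair _ (measurableTypeR R) k) _)).
    by apply: measurable_fun_pair => //; exact: (measurableT_comp mpost measurable_snd).
  by move=> xz; exact: f0.
have g0 x : (0 <= g x)%E by apply: integral_ge0.
pose F (t : V k.+1) := (f t *
  (\prod_(j < k.+1) normal_pdf (tnth t j) s (tnth [tuple of y0 :: y] j))%:E)%E.
have mF : measurable_fun setT F by apply: emeasurable_funM => //; exact: mprod.
have F0 t : (0 <= F t)%E by apply: mule_ge0; [exact: f0|exact: prod_ge0].
apply: etrans (ge0_integral_prob_power (gauss 0%R tau) mF F0) _; rewrite /F.
pose C := (\prod_(j < k) normal_pdf 0 c (tnth y j))%:E.
have C0 : (0 <= C)%E by rewrite lee_fin prodr_ge0// => i _; exact: normal_pdf_ge0.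
transitivity (\int[gauss 0%R tau]_x (C * (g x * (normal_pdf x s y0)%:E)))%E.
  apply: eq_integral => x _.
  transitivity (\int[prob_power (gauss 0%R tau) k]_t ((normal_pdf x s y0)%:E *
      (f (cons_pair (x, t)) * (\prod_(j < k) normal_pdf (tnth t j) s (tnth y j))%:E)))%E.
    apply: eq_integral => t _; rewrite big_ord_recl !tnth0 EFinM muleCA.
    congr (_ * (_ * _%:E))%E; apply: eq_bigr => j _.
    by rewrite /cons_pair !tnthS.
  rewrite ge0_integralZl//; first last.
  - by move=> t _; exact: mule_ge0.
  - by apply: emeasurable_funM => //; exact: mprod.
  by rewrite (IH y _ (mf1 x) (fun t => f0 _)) muleC -muleA.
rewrite ge0_integralZl//; first last.
- by move=> x _; exact: mule_ge0.
- exact: emeasurable_funM.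
rewrite (@integral_normal_bayes _ tau s y0 g tau0 s0 mg g0).
rewrite big_ord_recl tnth0 EFinM muleA [(C * _)%E]muleC; congr (_ * _ * _)%E.
  by congr EFin; apply: eq_bigr => j _; rewrite tnthS.
apply/esym; pose F' (z : V k.+1) :=
  f [tuple tau * s / c * tnth z j + tau ^+ 2 / c ^+ 2 * tnth [tuple of y0 :: y] j | j < k.+1].
have mF' : measurable_fun setT F'.
  exact: (measurableT_comp mf (measurable_tuple_affine _ _ _)).
apply: etrans (ge0_integral_prob_power (gauss 0%R 1%R) mF' (fun _ => f0 _)) _.
apply: eq_integral => x _; apply: eq_integral => z _; congr f.
by rewrite tuple_affine_cons [tau ^+ 2 / _ * _]mulrAC.
Qed.

(** By induction, convolving the first term with the sum of the others. For a unit vector [u] this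
    says that the linear functional is standard normal. *)
Lemma integral_gauss_vec_linear k (u : 'I_k -> R) (f : measurableTypeR R -> \bar R) :
  measurable_fun setT f -> (forall x, 0 <= f x)%E ->
  (\int[gauss_vec k]_z f (\sum_(j < k) u j * tnth z j)%R =
   \int[gauss 0%R 1%R]_x f (Num.sqrt (\sum_(j < k) u j ^+ 2) * x)%R)%E.
Proof.
elim: k u f => [|k IH] u f mf f0.
  rewrite big_ord0 sqrtr0.
  under eq_integral do rewrite big_ord0.
  under [RHS]eq_integral do rewrite mul0r.
  by rewrite !integral_probability_cst.
have msum : measurable_fun setT
    (fun z : V k.+1 => \sum_(j < k.+1) u j * tnth z j).
  apply: measurable_sum => j; apply: measurable_funM => //.
  exact: measurable_tnth.
pose F (z : V k.+1) := f (\sum_(j < k.+1) u j * tnth z j).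
have mF : measurable_fun setT F by exact: (measurableT_comp mf msum).
apply: etrans (ge0_integral_prob_power (gauss 0%R 1%R) mF (fun _ => f0 _)) _.
pose b := Num.sqrt (\sum_(j < k) u (lift ord0 j) ^+ 2).
transitivity (\int[gauss 0%R 1%R]_x \int[gauss 0%R 1%R]_y f (u ord0 * x + b * y)%R)%E.
  apply: eq_integral => x _.
  have mfx : measurable_fun setT (fun y : measurableTypeR R => f (u ord0 * x + y)).
    by apply: (measurableT_comp mf); exact: measurable_funD.
  apply: etrans (IH (fun j => u (lift ord0 j)) _ mfx (fun _ => f0 _)).
  apply: eq_integral => z _; rewrite /F big_ord_recl /cons_pair tnth0.
  by congr (f (_ + _)); apply: eq_bigr => j _; rewrite tnthS.
apply: etrans (integral_normal_convolution _ _ mf f0) _.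
rewrite sqr_sqrtr ?big_ord_recl// sumr_ge0// => j _; exact: sqr_ge0.
Qed.

(** The exact value is 1, but any finite constant serves. The integrand is at most 6 times the
    density of N(0, 4): this amounts to x^2 <= 3 exp u with u = 3 x^2 / 8, which follows from exp u
    >= 1 + u. *)
Lemma normal_second_moment_le :
  (\int[gauss (0%R : R) 1%R]_x (x ^+ 2)%:E <= 6%:E)%E.
Proof.
have msq : measurable_fun setT (fun x : measurableTypeR R => (x ^+ 2)%:E).
  by apply/measurable_EFinP; exact: measurable_funX.
have mpdf (s : R) : measurable_fun setT (fun x : measurableTypeR R => (normal_pdf 0 s x)%:E).
  by apply/measurable_EFinP; exact: measurable_normal_pdf.
rewrite (@ge0_integral_normal_prob _ 0 1 _ msq); last first.
  by move=> x; rewrite lee_fin sqr_ge0.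
have E : (\int[lebesgue_measure]_x (6%:E * (normal_pdf 0%R 2%R x)%:E) = 6%:E :> \bar R)%E.
  rewrite ge0_integralZl//.
  - by rewrite integral_normal_pdf mule1.
  - by move=> x _; rewrite lee_fin normal_pdf_ge0.
rewrite -E; apply: ge0_le_integral => //.
- by move=> x _; rewrite mule_ge0 ?lee_fin ?sqr_ge0 ?normal_pdf_ge0.
- exact: emeasurable_funM.
- by apply: emeasurable_funM.
move=> x _; rewrite -!EFinM lee_fin !normal_pdfE ?oner_eq0// /normal_peak /normal_fun.
rewrite expr1n mul1r -[2 ^+ 2 * pi *+ 2]mulrnAr sqrtrM ?sqr_ge0// sqrtr_sqr normr_nat subr0.
set p := Num.sqrt _.
have p0 : 0 < p by rewrite sqrtr_gt0 pmulrn_lgt0// pi_gt0.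
pose u := 3 * x ^+ 2 / 8.
have u1 : 1 + u <= expR u by exact: expR_ge1Dx.
have -> : - x ^+ 2 / (1 *+ 2) = - x ^+ 2 / (2 ^+ 2 *+ 2) - u.
  by rewrite /u; field.
rewrite expRD expRN.
have e0 : 0 < expR (- x ^+ 2 / (2 ^+ 2 *+ 2)) by exact: expR_gt0.
set e := expR _ in e0 *.
have -> : x ^+ 2 * (p^-1 * (e / expR u)) = (x ^+ 2 / expR u) * (e / p).
  by field; rewrite !gt_eqF ?expR_gt0.
have -> : 6 * ((2 * p)^-1 * e) = 3 * (e / p) by field; rewrite gt_eqF.
apply: ler_wpM2r; first by rewrite divr_ge0 ?ltW.
rewrite ler_pdivrMr ?expR_gt0//.
have : u = 3 * x ^+ 2 / 8 by [].
have := sqr_ge0 x; lra.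
Qed.

(** A coordinate is the linear functional whose weights are [(i == j)%:R]. *)
Lemma gauss_vec_second_moment_le k (j : 'I_k) :
  (\int[gauss_vec k]_z (tnth z j ^+ 2)%:E <= 6%:E)%E.
Proof.
have msq : measurable_fun setT (fun x : measurableTypeR R => (x ^+ 2)%:E).
  by apply/measurable_EFinP; exact: measurable_funX.
have sq0 (x : measurableTypeR R) : (0 <= (x ^+ 2)%:E)%E.
  by rewrite lee_fin sqr_ge0.
have sumd (g : 'I_k -> R) : \sum_(i < k) (i == j)%:R * g i = g j.
  rewrite (bigD1 j)//= eqxx mul1r big1 ?addr0// => i /negPf ->.
  by rewrite mul0r.
have E := @integral_gauss_vec_linear k (fun i => (i == j)%:R) _ msq sq0.
apply: le_trans normal_second_moment_le.
suff <- : (\int[gauss_vec k]_z (tnth z j ^+ 2)%:E =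
    \int[gauss (0%R : R) 1%R]_x (x ^+ 2)%:E)%E by [].
transitivity (\int[gauss_vec k]_z ((\sum_(i < k) (i == j)%:R * tnth z i) ^+ 2)%:E)%E.
  by apply: eq_integral => z _; rewrite sumd.
apply: etrans E _; apply: eq_integral => x _.
have -> : \sum_(i < k) ((i == j)%:R : R) ^+ 2 = 1.
  by under eq_bigr do rewrite expr2; rewrite sumd eqxx.
by rewrite sqrtr1 mul1r.
Qed.

End standard_gaussian_vector.

(** * Independent samples *)

Section independent_vector.
Context d (Omega : measurableType d) (R : realType) (P : probability Omega R).
Variables (X : nat -> {RV P >-> R}) (mu : probability (measurableTypeR R) R).
Hypothesis X_law : forall j (B : set R), measurable B -> distribution P (X j) B = mu B.
Hypothesis X_indep : mutually_independent X.

Local Notation T := (measurableTypeR R).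
Let block m k w : k.-tuple T := [tuple X (m + j)%N w | j < k].
Let cylinder m (B : nat -> set R) := \bigcap_(j in [set` iota 0 m]) (X j @^-1` B j).

Let measurable_block m k : measurable_fun setT (@block m k).
Proof.
apply/measurable_fun_tnthP => j.
apply: (eq_measurable_fun (X (m + j)%N)) => //.
by move=> w _; rewrite /= tnth_mktuple.
Qed.

Let measurable_cylinder m B : (forall j, measurable (B j)) -> measurable (cylinder m B).
Proof.
move=> mB; rewrite /cylinder bigcap_seq; apply: bigsetI_measurable => j _.
rewrite -[_ @^-1` _]setTI; exact: measurable_funP.
Qed.

(* The block [X m, ..., X (m + k - 1)] is split off one coordinate at a time: an
   event on [X m] is absorbed in the cylinder. *)
Let law_block k : forall m B, (forall j, measurable (B j)) ->
  forall A : set (k.-tuple T), measurable A ->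
  P (cylinder m B `&` (@block m k @^-1` A)) = (P (cylinder m B) * prob_power mu k A)%E.
Proof.
elim: k => [|k IH] m B mB A mA.
  rewrite /= diracE; have [At|At] := boolP ([tuple] \in A).
    rewrite mule1; congr (P _); apply/seteqP; split=> [w []//|w Bw]; split => //=.
    by rewrite /= (tuple0 (block _ _ _)) -inE.
  rewrite mule0 (_ : _ `&` _ = set0) ?measure0//; apply/seteqP; split => // w [_] /=.
  by rewrite (tuple0 (block _ _ _)) => /mem_set; rewrite (negPf At).
set p := P (cylinder m B).
have mC := measurable_cylinder m mB.
have pfin : p \is a fin_num by exact: fin_num_measure.
(* A null cylinder is set apart, since [p] is used below as a divisor. *)
have [p0|p0] := eqVneq p 0%E.
  rewrite p0 mul0e; apply/eqP; rewrite eq_le measure_ge0 andbT -p0.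
  have mb : measurable (block m k.+1 @^-1` A).
    by rewrite -[_ @^-1` _]setTI; exact: measurable_block.
  apply: le_measure; [rewrite inE; exact: measurableI|by rewrite inE|].
  exact: subIsetl.
have fp0 : 0 < fine p.
  by apply: fine_gt0; rewrite lt0e p0 ltey_eq pfin andbT /= /p; exact: measure_ge0.
pose phi w : T * k.-tuple T := (X m w, block m.+1 k w).
have mXm : measurable_fun setT (X m : Omega -> T).
  by move=> mD Y mY; exact: (measurable_funP (X m)).
have mphi := measurable_fun_pair mXm (@measurable_block m.+1 k).
have blockE w : block m k.+1 w = cons_pair (phi w).
  apply: eq_from_tnth => j; rewrite tnth_mktuple /cons_pair.
  case: (unliftP ord0 j) => [i|] ->; rewrite ?tnthS ?tnth0/= ?addn0//.
  by rewrite tnth_mktuple /bump/= add1n addnS addSn.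
have fp0' : 0 <= (fine p)^-1 by rewrite invr_ge0 ltW.
(* The joint law of [X m] and the remaining block, conditional on the cylinder. It is a product
   measure because it has the right values on rectangles. *)
pose nu := mscale (NngNum fp0')
  (image_measure (mrestr P mC) mphi).
have rect A1 A2 : measurable A1 -> measurable A2 ->
    nu (A1 `*` A2) = (mu A1 * prob_power mu k A2)%E.
  move=> mA1 mA2; rewrite /nu /= /mscale /= /pushforward /mrestr /=.
  pose B' j := if j == m then A1 else B j.
  have mB' j : measurable (B' j) by rewrite /B'; case: ifP => _; [exact: mA1|exact: mB].
  have cyl' : cylinder m.+1 B' = cylinder m B `&` X m @^-1` A1.
    have in_iota n j : [set` iota 0 n] j = (j < n)%N.
      by rewrite /mkset /= mem_iota add0n.
    apply/seteqP; split => [w Bw|w [Bw A1w] j].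
      split=> [j|]; last first.
        by have := Bw m; rewrite in_iota /B' eqxx; apply; rewrite ltnSn.
      have := Bw j; rewrite /B' !in_iota => Bj jm.
      by move: Bj; rewrite ltn_eqF//; apply; rewrite ltnS ltnW.
    rewrite in_iota ltnS leq_eqVlt /B' => /orP[/eqP ->|jm].
      by rewrite eqxx.
    by rewrite ltn_eqF//; apply: Bw; rewrite in_iota.
  have Pcyl' : P (cylinder m.+1 B') = (p * mu A1)%E.
    rewrite /p /cylinder !X_indep ?iota_uniq// -(addn1 m) iotaD big_cat/= big_seq1.
    rewrite add0n {2}/B' eqxx; congr (_ * _)%E; last exact: X_law.
    apply: eq_big_seq => j; rewrite mem_iota add0n /= => jm.
    by rewrite /B' ltn_eqF.
  have -> : phi @^-1` (A1 `*` A2) `&` cylinder m B =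
      cylinder m.+1 B' `&` block m.+1 k @^-1` A2.
    by rewrite cyl' -setIA setIC.
  rewrite IH// Pcyl' -(fineK pfin) !muleA -EFinM mulVf ?gt_eqF// mul1e.
  by [].
have mA' : measurable (cons_pair (k:=k) @^-1` A).
  by rewrite -[_ @^-1` _]setTI; exact: measurable_cons_pair.
have := product_measure_unique rect mA'.
rewrite /nu /= /mscale /= /pushforward /mrestr /= => E.
transitivity (p * (mu \x prob_power mu k)%E (cons_pair (k:=k) @^-1` A))%E; last by [].
rewrite E.
rewrite -(fineK pfin) muleA -EFinM mulfV ?gt_eqF// mul1e setIC.
by congr (P (_ `&` _)); apply/seteqP; split => w /=; rewrite blockE.
Qed.

(** The case of the empty cylinder. Here independence enters: events on the first [k] noise
    variables become events on a Gaussian vector. *)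
Lemma law_iid_tuple k (A : set (k.-tuple T)) : measurable A ->
  P [set w | [tuple X j w | j < k] \in A] = prob_power mu k A.
Proof.
move=> mA; have := @law_block k 0 (fun=> setT) (fun=> measurableT) A mA.
rewrite (_ : cylinder 0 _ = setT) ?probability_setT ?mul1e ?setTI => [<-|].
  by congr (P _); apply/seteqP; split => w; rewrite /= inE.
by apply/seteqP; split.
Qed.

End independent_vector.

(** * Comparison with the normal law *)

Section gaussian_comparison.
Context {R : realType}.

(** The density is at most its peak 1 / sqrt (2 pi) <= 1, and the interval has length 2 e. *)
Lemma normal_prob_ball_le (a e : R) : 0 < e ->
  (normal_prob 0 1 `[(a - e)%R, (a + e)%R]%classic <= (2 * e)%R%:E)%E.
Proof.
move=> e0; rewrite /normal_prob.
have mI : measurable (`[a - e, a + e]%classic : set (measurableTypeR R)).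
  exact: measurable_itv.
have -> : ((2 * e)%:E =
    \int[lebesgue_measure]_(x in `[(a - e)%R, (a + e)%R]) cst 1%:E (x : measurableTypeR R))%E.
  rewrite (integral_cst _ mI) mul1e.
  transitivity ((a + e)%:E - (a - e)%:E)%E; first by rewrite -EFinB; congr EFin; lra.
  have := lebesgue_measure_itv `[(a - e)%R, (a + e)%R].
  by rewrite /= lte_fin ltrD2l gt0_cp.
apply: ge0_le_integral => //.
  - by move=> x _; rewrite lee_fin normal_pdf_ge0.
  - apply/measurable_EFinP; apply: measurable_funTS; exact: measurable_normal_pdf.
  - move=> x _; rewrite lee_fin (le_trans (normal_pdf_ub _ _ (oner_neq0 _)))//.
  rewrite /normal_peak expr1n mul1r.
  have p1 : 1 <= (pi : R) *+ 2 by rewrite -mulr_natr; have := pi_ge2 R; lra.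
  move: ((pi : R) *+ 2) p1 => p p1.
  by rewrite invf_le1 ?sqrtr_gt0 ?(lt_le_trans _ p1)// -[leLHS]sqrtr1 ler_wsqrtr.
Qed.

(** When exactly one of [x], [y] lies in [I], an endpoint separates them. That [a] and [b] depend on
    [I] only confines the bad event to two fixed balls. *)
Lemma interval_boundary (I : interval R) : exists a b : R, forall x y : R,
  (x \in I) != (y \in I) -> `|y - a| <= `|x - y| \/ `|y - b| <= `|x - y|.
Proof.
case: I => l r.
(* The default 0 at an infinite bound is harmless: no two reals are separated by such a bound. *)
pose v (s : itv_bound R) := if s is BSide _ a then a else 0.
exists (v l), (v r) => x y.
have vl : (l <= BLeft x)%O != (l <= BLeft y)%O -> `|y - v l| <= `|x - y|.
  case: l => [[] a|[]] //=; rewrite !bnd_simp.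
    have [ax|ax] := leP a x; have [ay|ay] := leP a y => // _.
    - by rewrite ler0_norm; [rewrite ger0_norm|]; lra.
    - by rewrite ger0_norm; [rewrite ler0_norm|]; lra.
  have [ax|ax] := ltP a x; have [ay|ay] := ltP a y => // _.
  - by rewrite ler0_norm; [rewrite ger0_norm|]; lra.
  - by rewrite ger0_norm; [rewrite ler0_norm|]; lra.
have vr : (BRight x <= r)%O != (BRight y <= r)%O -> `|y - v r| <= `|x - y|.
  case: r => [[] a|[]] //=; rewrite !bnd_simp.
    have [ax|ax] := ltP x a; have [ay|ay] := ltP y a => // _.
    - by rewrite ger0_norm; [rewrite ler0_norm|]; lra.
    - by rewrite ler0_norm; [rewrite ger0_norm|]; lra.
  have [ax|ax] := leP x a; have [ay|ay] := leP y a => // _.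
  - by rewrite ger0_norm; [rewrite ler0_norm|]; lra.
  - by rewrite ler0_norm; [rewrite ger0_norm|]; lra.
rewrite !itv_boundlr.
have [->|ll] := eqVneq (l <= BLeft x)%O (l <= BLeft y)%O; last by left; exact: vl.
have [->|rr] := eqVneq (BRight x <= r)%O (BRight y <= r)%O; last by right; exact: vr.
by rewrite eqxx.
Qed.

Lemma interval_dist_normal_le d (T : measurableType d) (mu : probability T R)
    (W G D : T -> measurableTypeR R) (e delta : R) (I : interval R) :
  measurable_fun setT W -> measurable_fun setT G -> measurable_fun setT D ->
  (forall t, `|W t - G t| <= D t) ->
  (forall B : set (measurableTypeR R), measurable B -> mu (G @^-1` B) = normal_prob 0 1 B) ->
  (\int[mu]_t (D t)%:E <= e%:E)%E -> 0 < delta ->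
  (`|mu (W @^-1` [set` I]) - normal_prob 0 1 [set` I]| <= (e / delta + 4 * delta)%:E)%E.
Proof.
move=> mW mG mD WGD lawG De d0.
have [a [b ab]] := interval_boundary I.
have mI : measurable ([set` I] : set (measurableTypeR R)) by exact: measurable_itv.
pose E1 := D @^-1` `[delta, +oo[%classic.
pose E2 := G @^-1` `[a - delta, a + delta]%classic.
pose E3 := G @^-1` `[b - delta, b + delta]%classic.
have mpre (f : T -> measurableTypeR R) (A : set (measurableTypeR R)) :
    measurable_fun setT f -> measurable A -> measurable (f @^-1` A).
  by move=> mf mA; rewrite -[_ @^-1` _]setTI; exact: mf.
have mE1 : measurable E1 by apply: mpre => //; exact: measurable_itv.
have mE2 : measurable E2 by apply: mpre => //; exact: measurable_itv.
have mE3 : measurable E3 by apply: mpre => //; exact: measurable_itv.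
(* Markov's inequality. *)
have E1_le : (mu E1 <= (e / delta)%:E)%E.
  have D0 t : 0 <= D t by exact: le_trans (WGD t).
  rewrite EFinM muleC lee_pdivlMl//.
  apply: le_trans De.
  have -> : (delta%:E * mu E1 = \int[mu]_(t in E1) (cst delta%:E t))%E.
    by rewrite integral_cst.
  apply: (@le_trans _ _ (\int[mu]_(t in E1) (D t)%:E)%E).
    apply: ge0_le_integral => //.
    - by move=> t _; rewrite lee_fin ltW.
    - by apply/measurable_EFinP; apply: measurable_funTS.
    - by move=> t; rewrite /E1 /= in_itv/= andbT lee_fin.
  apply: ge0_subset_integral => //.
  - by apply/measurable_EFinP.
  - by move=> t _; rewrite lee_fin.
have E2_le : (mu E2 <= (2 * delta)%:E)%E.
  by rewrite lawG; [exact: normal_prob_ball_le|exact: measurable_itv].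
have E3_le : (mu E3 <= (2 * delta)%:E)%E.
  by rewrite lawG; [exact: normal_prob_ball_le|exact: measurable_itv].
(* The exceptional set is the same with [W] and [G] exchanged, so one estimate gives both sides of
   the absolute value. *)
have EUle (U V : T -> measurableTypeR R) : measurable_fun setT U -> measurable_fun setT V ->
    U @^-1` [set` I] `<=` V @^-1` [set` I] `|` (E1 `|` (E2 `|` E3)) ->
    (mu (U @^-1` [set` I]) <= mu (V @^-1` [set` I]) + (e / delta + 4 * delta)%:E)%E.
  move=> mU mV UV.
  apply: (@le_trans _ _ (mu (V @^-1` [set` I] `|` (E1 `|` (E2 `|` E3))))).
    by apply: le_measure => //; rewrite inE; do ?apply: measurableU => //; exact: mpre.
  apply: (le_trans (measureU2 _ _ _)) => //; first exact: mpre.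
    by do ?apply: measurableU.
  rewrite leeD2l//; apply: (le_trans (measureU2 _ _ _)) => //.
    by do ?apply: measurableU.
  rewrite EFinD leeD//; apply: (le_trans (measureU2 _ _ _)) => //.
  apply: (le_trans (leeD E2_le E3_le)); rewrite -EFinD lee_fin; lra.
have cover t : (W t \in I) != (G t \in I) -> (E1 `|` (E2 `|` E3)) t.
  move=> WG; have [dD|Dd] := leP delta (D t).
    by left; rewrite /E1 /= in_itv/= dD.
  have WGd := le_lt_trans (WGD t) Dd.
  right; have [h|h] := ab _ _ WG; [left|right].
    by rewrite /E2 /= in_itv/= -ler_distl (le_trans h)// ltW.
  by rewrite /E3 /= in_itv/= -ler_distl (le_trans h)// ltW.
have h1 : (mu (W @^-1` [set` I]) <= mu (G @^-1` [set` I]) + (e / delta + 4 * delta)%:E)%E.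
  apply: EUle => // t /= Wt; have [Gt|Gt] := boolP (G t \in I); first by left.
  by right; apply: cover; rewrite Wt (negPf Gt).
have h2 : (mu (G @^-1` [set` I]) <= mu (W @^-1` [set` I]) + (e / delta + 4 * delta)%:E)%E.
  apply: EUle => // t /= Gt; have [Wt|Wt] := boolP (W t \in I); first by left.
  by right; apply: cover; rewrite Gt (negPf Wt).
rewrite lawG// in h1 h2.
have f1 : mu (W @^-1` [set` I]) \is a fin_num by apply: fin_num_measure; exact: mpre.
have f2 : normal_prob 0 1 [set` I] \is a fin_num.
  by rewrite -lawG//; apply: fin_num_measure; exact: mpre.
move: h1 h2; rewrite -(fineK f1) -(fineK f2).
move: (fine _) (fine _) => r1 r2; rewrite -!EFinD !lee_fin => h1 h2.
by rewrite ler_norml; apply/andP; split; lra.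
Qed.

End gaussian_comparison.

(** * Bounds on expectations *)

Section integral_bounds.
Local Open Scope ereal_scope.
Context d (T : measurableType d) (R : realType).

(* [bvm_error] is a supremum over uncountably many intervals: its measurability in the
   noise is not available. *)
Lemma integral_monotone (mu : {measure set T -> \bar R}) (f g : T -> \bar R) :
  (forall x, 0 <= f x) -> (forall x, f x <= g x) ->
  \int[mu]_x f x <= \int[mu]_x g x.
Proof.
move=> f0 fg; have g0 x : 0 <= g x by exact: le_trans (fg x).
rewrite !ge0_integralTE//; apply: ereal_sup_le.
by move=> _ [h hf <-]; exists h => // x; exact: le_trans (hf x) (fg x).
Qed.

Lemma integral_affine_le (mu : probability T R) (a b c : R) (f g : T -> R) (F G : R) :
  (0 <= a)%R -> (0 <= b)%R -> (0 <= c)%R ->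
  measurable_fun setT f -> measurable_fun setT g ->
  (forall x, 0 <= f x)%R -> (forall x, 0 <= g x)%R ->
  \int[mu]_x (f x)%:E <= F%:E -> \int[mu]_x (g x)%:E <= G%:E ->
  \int[mu]_x (a + b * f x + c * g x)%:E <= (a + b * F + c * G)%:E.
Proof.
move=> a0 b0 c0 /measurable_EFinP mf /measurable_EFinP mg f0 g0 fF gG.
under eq_integral do rewrite !EFinD !EFinM.
rewrite ge0_integralD//; first last.
- by apply: emeasurable_funM.
- by move=> x _; rewrite mule_ge0 ?lee_fin.
- by apply: emeasurable_funD => //; exact: emeasurable_funM.
- by move=> x _; rewrite adde_ge0 ?mule_ge0 ?lee_fin.
rewrite ge0_integralD//; first last.
- by apply: emeasurable_funM.
- by move=> x _; rewrite mule_ge0 ?lee_fin.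
rewrite integral_probability_cst !ge0_integralZl ?lee_fin//; first last.
- by move=> x _; rewrite lee_fin.
- by move=> x _; rewrite lee_fin.
rewrite !EFinD !EFinM; apply: leeD; [apply: leeD => //|];
  by apply: lee_wpmul2l; rewrite ?lee_fin.
Qed.

Lemma integral_sum_sq_le (mu : probability T R) k (X : 'I_k -> T -> R) :
  (forall j, measurable_fun setT (X j)) ->
  (forall j, \int[mu]_x (X j x ^+ 2)%:E <= 6%:E) ->
  \int[mu]_x (\sum_(j < k) X j x ^+ 2)%:E <= (6 * k%:R)%:E.
Proof.
move=> mX X6; under eq_integral do rewrite -sumEFin.
rewrite ge0_integral_sum//; first last.
- by move=> j x _; rewrite lee_fin sqr_ge0.
- by move=> j; apply/measurable_EFinP; exact: measurable_funX.
apply: (@le_trans _ _ (\sum_(j < k) 6%:E)); first by apply: lee_sum => j _; exact: X6.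
by rewrite sumEFin lee_fin sumr_const card_ord -[leLHS]mulr_natr.
Qed.
End integral_bounds.

(** * Quadratic forms of a Gaussian vector *)

Section quadratic_form.
Context {R : realType}.
Local Notation V k := (k.-tuple (measurableTypeR R)).
Local Notation gauss_vec k := (prob_power (gauss (0:R) 1) k).

(** In W - G = a + (b - 1) G + c S, the bound |G| <= 1 + G^2 leaves second moments only: 7 is 1 + 6,
    and [S] has mean at most 6 k. *)
Lemma gauss_vec_quadratic k (u : 'I_k -> R) (a b c delta : R) (I : interval R) :
  \sum_(j < k) u j ^+ 2 = 1 -> 0 <= c -> 0 < delta ->
  (`|gauss_vec k [set z | (a + b * (\sum_(j < k) u j * tnth z j) +
       c * (\sum_(j < k) tnth z j ^+ 2))%R \in I] - normal_prob 0 1 [set` I]| <=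
   ((`|a| + 7 * `|b - 1| + 6 * c * k%:R) / delta + 4 * delta)%:E)%E.
Proof.
move=> u1 c0 d0.
pose G (z : V k) : measurableTypeR R := \sum_(j < k) u j * tnth z j.
pose S (z : V k) : measurableTypeR R := \sum_(j < k) tnth z j ^+ 2.
have mG : measurable_fun setT G.
  by apply: measurable_sum => j; apply: measurable_funM => //; exact: measurable_tnth.
have mS : measurable_fun setT S.
  by apply: measurable_sum => j; apply: measurable_funX => //; exact: measurable_tnth.
have S0 z : 0 <= S z by rewrite sumr_ge0// => j _; exact: sqr_ge0.
pose W (z : V k) : measurableTypeR R := a + b * G z + c * S z.
pose D (z : V k) : measurableTypeR R := (`|a| + `|b - 1|) + `|b - 1| * G z ^+ 2 + c * S z.
have mW : measurable_fun setT W.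
  by apply: measurable_funD; [apply: measurable_funD => //|]; exact: measurable_funM.
have mD : measurable_fun setT D.
  apply: measurable_funD; last exact: measurable_funM.
  by apply: measurable_funD => //; apply: measurable_funM => //; exact: measurable_funX.
have WGD z : `|W z - G z| <= D z.
  rewrite /W /D; have -> : a + b * G z + c * S z - G z = a + (b - 1) * G z + c * S z by ring.
  have G1 : `|G z| <= 1 + G z ^+ 2.
    by rewrite -(real_normK (num_real (G z))); have := sqr_ge0 (`|G z| - 1); nra.
  apply: (le_trans (ler_normD _ _)); rewrite (ger0_norm (mulr_ge0 c0 (S0 z))) lerD2r.
  apply: (le_trans (ler_normD _ _)); rewrite -addrA lerD2l normrM.
  by apply: (le_trans (ler_wpM2l (normr_ge0 _) G1)); rewrite mulrDr mulr1.
have lawG (B : set (measurableTypeR R)) : measurable B ->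
    gauss_vec k (G @^-1` B) = normal_prob 0 1 B.
  move=> mB.
  have mB1 : measurable_fun setT (EFin \o \1_B : measurableTypeR R -> \bar R).
    by apply/measurable_EFinP; exact: measurable_indic.
  have B0 x : (0 <= (EFin \o \1_B) x :> \bar R)%E by rewrite lee_fin.
  have := @integral_gauss_vec_linear R k u _ mB1 B0.
  rewrite u1 sqrtr1.
  have mGB : measurable (G @^-1` B) by rewrite -[_ @^-1` _]setTI; exact: mG.
  have -> : (\int[gauss_vec k]_z (EFin \o \1_B) (\sum_(j < k) u j * tnth z j)%R =
      gauss_vec k (G @^-1` B))%E.
    by rewrite -[X in gauss_vec k X]setIT -integral_indic.
  move=> ->.
  rewrite -[in RHS](setIT B) -[RHS](@integral_indic _ _ _ (gauss 0 1) setT)//.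
  by apply: eq_integral => x _; rewrite /= mul1r.
have G6 : (\int[gauss_vec k]_z (G z ^+ 2)%:E <= 6%:E)%E.
  have msq : measurable_fun setT (fun x : measurableTypeR R => (x ^+ 2)%:E).
    by apply/measurable_EFinP; exact: measurable_funX.
  have sq0 (x : measurableTypeR R) : (0 <= (x ^+ 2)%:E)%E.
    by rewrite lee_fin sqr_ge0.
  have E := @integral_gauss_vec_linear R k u _ msq sq0.
  apply: le_trans (normal_second_moment_le (R := R)).
  suff <- : (\int[gauss_vec k]_z (G z ^+ 2)%:E =
      \int[gauss (0%R : R) 1%R]_x (x ^+ 2)%:E)%E by [].
  apply: etrans E _; apply: eq_integral => x _.
  by rewrite u1 sqrtr1 mul1r.
have S6 : (\int[gauss_vec k]_z (S z)%:E <= (6 * k%:R)%:E)%E.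
  apply: (@integral_sum_sq_le _ _ _ (gauss_vec k) k (fun j z => tnth z j)) => j.
    exact: measurable_tnth.
  exact: gauss_vec_second_moment_le.
have DE : (\int[gauss_vec k]_z (D z)%:E <=
    (`|a| + 7 * `|b - 1| + 6 * c * k%:R)%:E)%E.
  have -> : `|a| + 7 * `|b - 1| + 6 * c * k%:R =
    (`|a| + `|b - 1|) + `|b - 1| * 6 + c * (6 * k%:R) by ring.
  apply: integral_affine_le => //; last by move=> z; exact: sqr_ge0.
  - exact: measurable_funX.
exact: (interval_dist_normal_le I mW mG mD WGD lawG DE d0).
Qed.
End quadratic_form.

(** * The posterior *)

(** Normalisation made total: if [y] vanishes any unit vector serves, and one exists because
    [0 < k]. *)
Lemma unit_direction (R : rcfType) k (y : 'I_k -> R) : (0 < k)%N ->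
  exists2 u : 'I_k -> R, \sum_(j < k) u j ^+ 2 = 1 &
    forall j, y j = Num.sqrt (\sum_(j < k) y j ^+ 2) * u j.
Proof.
case: k y => // k y _; set N2 := \sum_(j < k.+1) y j ^+ 2.
have N20 : 0 <= N2 by rewrite sumr_ge0// => j _; exact: sqr_ge0.
have [N0|N0] := eqVneq N2 0.
  exists (fun j => (j == ord0)%:R).
    rewrite (bigD1 ord0)//= ?eqxx expr1n big1 ?addr0// => j /negPf ->.
    by rewrite expr0n.
  move=> j; rewrite N0 sqrtr0 mul0r; apply/eqP; rewrite -sqrf_eq0.
  rewrite eq_le sqr_ge0 andbT -N0 /N2 (bigD1 j)//= lerDl sumr_ge0// => i _.
  exact: sqr_ge0.
have sN0 : Num.sqrt N2 != 0 by rewrite sqrtr_eq0 -ltNge lt_def N0.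
exists (fun j => y j / Num.sqrt N2); last by move=> j; rewrite mulrC divfK.
under eq_bigr do rewrite expr_div_n sqr_sqrtr//.
by rewrite -mulr_suml divff.
Qed.

Section gaussian_posterior.
Context {R : realType}.
Local Notation V k := (k.-tuple (measurableTypeR R)).
Local Notation gauss_vec k := (prob_power (gauss (0:R) 1) k).

(** Here [s] is sqrt n, the inverse of the s of the overview. The three terms over [delta] bound
    |a|, 7 |b - 1| and 6 c k; the shrinkage [r] is arbitrary in [0, 1] to cover both the posterior
    and the fluctuation. *)
Lemma gauss_vec_sq_diff k (y : V k) (n : nat) (r l delta : R) (I : interval R)
    (s := Num.sqrt n%:R) (N2 := \sum_(j < k) tnth y j ^+ 2) (q := s * (1 - r ^+ 2)) :
  (0 < k)%N -> (0 < n)%N -> 0 <= r <= 1 -> 0 < l -> 0 < delta ->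
  (`|gauss_vec k [set z |
        (s * (\sum_(j < k) (r / s * tnth z j + r ^+ 2 * tnth y j) ^+ 2 - N2) / (2 * l))%R
          \in I] - normal_prob 0 1 [set` I]| <=
   ((q * N2 / l + 7 * (`|N2 - l ^+ 2| / l ^+ 2 + 2 * q) + 3 * k%:R / (s * l)) / delta
     + 4 * delta)%:E)%E.
Proof.
move=> k0 n0 /andP[r0 r1] l0 d0.
have [u u1 yu] := unit_direction (tnth y) k0.
have s1 : 1 <= s by rewrite -[leLHS]sqrtr1 ler_wsqrtr// ler1n.
have s0 : 0 < s by exact: lt_le_trans s1.
have N20 : 0 <= N2 by rewrite sumr_ge0// => j _; exact: sqr_ge0.
rewrite -/N2 in yu; set N := Num.sqrt N2 in yu.
have NE : N ^+ 2 = N2 by rewrite sqr_sqrtr.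
have N0 : 0 <= N by exact: sqrtr_ge0.
have r21 : r ^+ 2 <= 1 by rewrite expr_le1.
have q0 : 0 <= q by rewrite mulr_ge0 ?(ltW s0)// subr_ge0.
pose a := s * (r ^+ 4 - 1) * N2 / (2 * l).
pose b := r ^+ 3 * N / l.
pose c := r ^+ 2 / (2 * s * l).
have c0 : 0 <= c by rewrite divr_ge0 ?sqr_ge0// ltW// !mulr_gt0.
rewrite (_ : [set z | _] = [set z : V k | (a + b * (\sum_(j < k) u j * tnth z j) +
       c * (\sum_(j < k) tnth z j ^+ 2))%R \in I]); last first.
  apply/funext => z /=; congr (is_true (_ \in I)).
  have -> : \sum_(j < k) (r / s * tnth z j + r ^+ 2 * tnth y j) ^+ 2 =
      (r / s) ^+ 2 * (\sum_(j < k) tnth z j ^+ 2) +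
      2 * r ^+ 3 * N / s * (\sum_(j < k) u j * tnth z j) + r ^+ 4 * N2.
    rewrite /N2 !mulr_sumr -!big_split/=; apply: eq_bigr => j _.
    rewrite yu; field; exact: lt0r_neq0.
  by rewrite /a /b /c; field; rewrite !lt0r_neq0.
apply: le_trans (gauss_vec_quadratic a b I u1 c0 d0) _.
rewrite lee_fin lerD2r ler_wpM2r ?invr_ge0 ?(ltW d0)//.
(* The difference of the two sides is (1 - r^2)^2. *)
have r4 : 1 - r ^+ 4 <= 2 * (1 - r ^+ 2).
  by rewrite (_ : r ^+ 4 = (r ^+ 2) ^+ 2) -?exprM//; have := sqr_ge0 (1 - r ^+ 2); nra.
have ha : `|a| <= q * N2 / l.
  have -> : a = - (s * (1 - r ^+ 4) * N2 / (2 * l)) by rewrite /a; ring.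
  rewrite normrN ger0_norm; last first.
    by rewrite divr_ge0 ?mulr_ge0 ?(ltW s0) ?(ltW l0)// subr_ge0 exprn_ile1.
  have -> : q * N2 / l = s * (2 * (1 - r ^+ 2)) * N2 / (2 * l).
    by rewrite /q; field; rewrite lt0r_neq0.
  rewrite ler_wpM2r ?invr_ge0 ?mulr_ge0 ?(ltW l0)// ler_wpM2r// ler_wpM2l ?(ltW s0)//.
(* The error of the norm is separated from the shrinkage. As N / l + 1 >= 1, |N / l - 1| is at most
   |N^2 - l^2| / l^2, which removes the square root; and 1 - r^3 <= 1 - r^4 <= 2 (1 - r^2) <= 2 q
   because s >= 1. *)
have hb : `|b - 1| <= `|N2 - l ^+ 2| / l ^+ 2 + 2 * q.
  have -> : b - 1 = r ^+ 3 * (N / l - 1) - (1 - r ^+ 3) by rewrite /b; ring.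
  apply: (le_trans (ler_normB _ _)); apply: lerD.
    rewrite normrM ger0_norm ?exprn_ge0//.
    apply: (@le_trans _ _ `|N / l - 1|); first by rewrite ler_piMl// exprn_ile1.
    have -> : `|N2 - l ^+ 2| / l ^+ 2 = `|N / l - 1| * (N / l + 1).
      have -> : N2 - l ^+ 2 = l ^+ 2 * ((N / l - 1) * (N / l + 1)).
        by rewrite -NE; field; rewrite lt0r_neq0.
      have Nl : 0 <= N / l + 1 by rewrite addr_ge0// divr_ge0// ltW.
      rewrite normrM (ger0_norm (sqr_ge0 l)) normrM (ger0_norm Nl) mulrAC mulfV ?mul1r//.
      by rewrite expf_neq0// lt0r_neq0.
    by rewrite ler_peMr// lerDr divr_ge0// ltW.
  have r43 : r ^+ 4 <= r ^+ 3 by rewrite exprS ler_piMl// exprn_ge0.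
  rewrite ger0_norm ?subr_ge0 ?exprn_ile1//.
  apply: (@le_trans _ _ (2 * (1 - r ^+ 2))); first by lra.
  by rewrite /q ler_wpM2l// ler_peMl// subr_ge0.
have hc : 6 * c * k%:R <= 3 * k%:R / (s * l).
  have -> : 6 * c * k%:R = r ^+ 2 * (3 * k%:R / (s * l)).
    by rewrite /c; field; rewrite !lt0r_neq0.
  by rewrite ler_piMl// divr_ge0 ?mulr_ge0// ltW// mulr_gt0.
by rewrite lerD// lerD// ler_wpM2l.
Qed.

(** Numerator and denominator of Bayes' formula share the factor [K], the marginal density of [y],
    which is positive and cancels. *)
Lemma posterior_gaussian k (n : nat) (tau : R) (y : V k) (A : set (V k))
    (s := (Num.sqrt n%:R)^-1) (r := tau / Num.sqrt (tau ^+ 2 + s ^+ 2)) :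
  (0 < n)%N -> 0 < tau -> measurable A ->
  posterior (gaussian_prior tau k) (likelihood n y) A =
  fine (gauss_vec k [set z | [tuple r * s * tnth z j + r ^+ 2 * tnth y j | j < k] \in A]).
Proof.
move=> n0 tau0 mA.
have s0 : 0 < s by rewrite invr_gt0 sqrtr_gt0 ltr0n.
set c := Num.sqrt _ in r *.
pose K := \prod_(j < k) normal_pdf 0 c (tnth y j).
have c0 : 0 < c by rewrite sqrtr_gt0 ltr_wpDl ?sqr_ge0 ?exprn_gt0.
have K0 : 0 < K.
  apply: prodr_gt0 => j _.
  by rewrite normal_pdfE ?gt_eqF// mulr_gt0 ?normal_peak_gt0 ?expR_gt0 ?gt_eqF.
pose post (z : V k) : V k := [tuple r * s * tnth z j + r ^+ 2 * tnth y j | j < k].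
have postE (z : V k) : post z =
    [tuple tau * s / c * tnth z j + tau ^+ 2 / c ^+ 2 * tnth y j | j < k].
  by apply: eq_from_tnth => j; rewrite !tnth_mktuple /r; field; rewrite lt0r_neq0.
have mpost : measurable_fun setT post.
  exact: measurable_tuple_affine.
have num (B : set (V k)) : measurable B ->
    (\int[gaussian_prior tau k]_(t in B) likelihood n y t)%R =
    K * fine (gauss_vec k (post @^-1` B)).
  move=> mB; rewrite /Rintegral integral_mkcond.
  have mB1 : measurable_fun setT (EFin \o \1_B : V k -> \bar R).
    by apply/measurable_EFinP; exact: measurable_indic.
  have B0 t : (0 <= (EFin \o \1_B) t :> \bar R)%E by rewrite lee_fin.
  have E := integral_prob_power_bayes y tau0 s0 mB1 B0.
  have mpB : measurable (post @^-1` B) by rewrite -[_ @^-1` _]setTI; exact: mpost.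
  have -> : (\int[gaussian_prior tau k]_t ((EFin \o likelihood n y) \_ B) t =
      K%:E * gauss_vec k (post @^-1` B))%E.
    rewrite -[X in gauss_vec k X]setIT -integral_indic//.
    apply: etrans (etrans E _).
      apply: eq_integral => t _; rewrite /= patchE /likelihood indicE.
      by case: ifPn => tB; rewrite -EFinM ?mul1r ?mul0r.
    by congr (_ * _)%E; apply: eq_integral => z _; rewrite -postE.
  by rewrite fineM//; apply: fin_num_measure.
rewrite /posterior num// num//.
have -> : gauss_vec k (post @^-1` setT) = 1%E by rewrite preimage_setT probability_setT.
rewrite mulr1 mulrC mulKf ?gt_eqF//; congr (fine (_ _)).
by apply/seteqP; split => z /=; rewrite inE.
Qed.

End gaussian_posterior.

(** * Bounds at a fixed sample size *)

Section gaussian_sequence_bounds.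
Context {R : realType}.
Local Notation V k := (k.-tuple (measurableTypeR R)).
Local Notation gauss_vec k := (prob_power (gauss (0:R) 1) k).

Lemma interval_dist_ge0 (f : set R -> R) (g : set R -> \bar R) :
  (0 <= interval_dist f g)%E.
Proof.
apply: (@le_trans _ _ `|(f [set` `]0%R, 0%R[])%:E - g [set` `]0%R, 0%R[]|%E).
  exact: abse_ge0.
by apply: ereal_sup_ubound; exists `]0%R, 0%R[.
Qed.

Lemma sqr_euclid_norm k (t : k.-tuple R) : euclid_norm t ^+ 2 = \sum_(j < k) tnth t j ^+ 2.
Proof. by rewrite sqr_sqrtr// sumr_ge0// => j _; exact: sqr_ge0. Qed.

Lemma measurable_scaled_sq_diff (theta0 : nat -> R) n k (y : R)
    (B : set (measurableTypeR R)) : measurable B ->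
  measurable [set t : V k | scaled_sq_diff theta0 n (euclid_norm t) y \in B].
Proof.
move=> mB; pose W (t : V k) : measurableTypeR R :=
  Num.sqrt n%:R * (\sum_(j < k) tnth t j ^+ 2 - y ^+ 2) / (2 * l2_norm theta0).
have mW : measurable_fun setT W.
  apply: measurable_funM => //; apply: measurable_funM => //.
  apply: measurable_funB => //; apply: measurable_sum => j.
  apply: measurable_funX; exact: measurable_tnth.
have := mW measurableT _ mB; rewrite setTI; congr measurable.
by apply/seteqP; split => t /=; rewrite /scaled_sq_diff sqr_euclid_norm inE.
Qed.

Section fixed_sample_size.
Variables (theta0 : nat -> R) (k n : nat).
Hypotheses (k_gt0 : (0 < k)%N) (n_gt0 : (0 < n)%N).
Let l := l2_norm theta0.
Hypothesis l_gt0 : 0 < l.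
Let s := (Num.sqrt n%:R : R)^-1.
Let H := \sum_(j < k) theta0 j ^+ 2.

Let sqn_gt0 : 0 < Num.sqrt n%:R :> R.
Proof. by rewrite sqrtr_gt0 ltr0n. Qed.

Let s_gt0 : 0 < s.
Proof. by rewrite invr_gt0. Qed.

Let s_le1 : s <= 1.
Proof. by rewrite invf_le1// -[leLHS]sqrtr1 ler_wsqrtr// ler1n. Qed.

(** The bound for one interval does not involve the interval, so it passes to the supremum; it
    depends on the noise through [N2] only. *)
Lemma bvm_error_le (tau delta : R) (xi : nat -> R) (r := tau / Num.sqrt (tau ^+ 2 + s ^+ 2))
    (q := Num.sqrt n%:R * (1 - r ^+ 2)) (N2 := \sum_(j < k) obs theta0 n xi j ^+ 2) :
  0 < tau -> 0 < delta ->
  (bvm_error theta0 tau k n xi <=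
   ((q * N2 / l + 7 * (`|N2 - l ^+ 2| / l ^+ 2 + 2 * q) + 3 * k%:R / (Num.sqrt n%:R * l)) / delta
     + 4 * delta)%:E)%E.
Proof.
move=> tau0 d0; apply: ge_ereal_sup => _ [I _ <-].
set Y := first_coords k (obs theta0 n xi).
have c0 : 0 < Num.sqrt (tau ^+ 2 + s ^+ 2).
  by rewrite sqrtr_gt0 ltr_wpDl ?sqr_ge0 ?exprn_gt0.
have r01 : 0 <= r <= 1.
  rewrite /r divr_ge0 ?(ltW tau0) ?(ltW c0)//= ler_pdivrMr// mul1r.
  by rewrite -[leLHS]gtr0_norm// -sqrtr_sqr ler_wsqrtr// lerDl sqr_ge0.
have N2E : \sum_(j < k) tnth Y j ^+ 2 = N2.
  by apply: eq_bigr => j _; rewrite tnth_mktuple.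
have mI : measurable ([set` I] : set (measurableTypeR R)) by exact: measurable_itv.
have mA := @measurable_scaled_sq_diff theta0 n k (euclid_norm Y) _ mI.
rewrite posterior_gaussian//.
have := gauss_vec_sq_diff Y I k_gt0 n_gt0 r01 l_gt0 d0; rewrite N2E -/q.
set B := (X in fine (_ X)); set A := (X in (`|prob_power _ k X - _|)%E).
have WE (z : V k) : Num.sqrt n%:R * (\sum_(j < k)
      (r / Num.sqrt n%:R * tnth z j + r ^+ 2 * tnth Y j) ^+ 2 - N2) / (2 * l) =
    scaled_sq_diff theta0 n
      (euclid_norm [tuple r * s * tnth z j + r ^+ 2 * tnth Y j | j < k]) (euclid_norm Y).
  rewrite /scaled_sq_diff !sqr_euclid_norm N2E; congr (_ * (_ - _) / _).
  by apply: eq_bigr => j _; rewrite [in RHS]tnth_mktuple.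
have -> : A = B.
  by apply/seteqP; split => z; rewrite /A /B /= !inE /= WE inE.
rewrite fineK//; apply: fin_num_measure; rewrite /B.
have := @measurable_tuple_affine R k (r * s) (r ^+ 2) Y measurableT _ mA.
rewrite setTI; congr measurable.
by apply/seteqP; split => z; [exact: mem_set|exact: set_mem].
Qed.

(** Each coordinate contributes s (2 theta xi + s xi^2), where 2 |theta xi| <= theta^2 + xi^2 and s
    <= 1. *)
Lemma sum_obs_sq_dist (xi : nat -> R) :
  `|\sum_(j < k) obs theta0 n xi j ^+ 2 - H| <= (H + 2 * \sum_(j < k) xi j ^+ 2) * s.
Proof.
rewrite /H -sumrB mulr_sumr -big_split/= mulr_suml.
apply: (le_trans (ler_norm_sum _ _ _)); apply: ler_sum => j _.
rewrite /obs -/s (_ : _ - _ = s * (2 * theta0 j * xi j + s * xi j ^+ 2)); last by ring.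
rewrite normrM (gtr0_norm s_gt0) mulrC ler_wpM2r ?(ltW s_gt0)//.
apply: (le_trans (ler_normD _ _)).
rewrite [X in _ + X]ger0_norm; last by rewrite mulr_ge0 ?sqr_ge0 ?(ltW s_gt0).
have h1 : `|2 * theta0 j * xi j| <= theta0 j ^+ 2 + xi j ^+ 2.
  rewrite ler_norml; have := sqr_ge0 (theta0 j + xi j); have := sqr_ge0 (theta0 j - xi j).
  by move=> h2 h3; apply/andP; split; nra.
have h2 : s * xi j ^+ 2 <= xi j ^+ 2 by rewrite ler_piMl ?sqr_ge0.
by have := lerD h1 h2; lra.
Qed.

(** One [eta] dominates the tail, the effect of the prior and k s, hence also s since k >= 1. With
    [eta <= 1] the product of [eta] and the noise is absorbed, so the bound is affine in the sum of
    the xi_j^2; 21 is 7 + 14. *)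
Lemma bvm_error_le_noise (tau delta eta : R) (xi : nat -> R)
    (r := tau / Num.sqrt (tau ^+ 2 + s ^+ 2)) :
  0 < tau -> 0 < delta -> 0 <= eta <= 1 -> H <= l ^+ 2 ->
  l ^+ 2 - H <= eta -> Num.sqrt n%:R * (1 - r ^+ 2) <= eta -> k%:R * s <= eta ->
  (bvm_error theta0 tau k n xi <=
   ((2 * l + 7 / l ^+ 2 + 21 + 3 / l) * eta / delta + 4 * delta +
    (2 / l + 14 / l ^+ 2) * s / delta * (\sum_(j < k) xi j ^+ 2))%:E)%E.
Proof.
move=> tau0 d0 /andP[eta0 eta1] Hl Heta qeta keta.
apply: (le_trans (bvm_error_le _ tau0 d0)); rewrite lee_fin.
set N2 := \sum_(j < k) obs _ _ _ _ ^+ 2; set q := _ * (1 - _) in qeta *.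
set S := \sum_(j < k) xi _ ^+ 2.
have NH : `|N2 - H| <= (H + 2 * S) * s by exact: sum_obs_sq_dist.
have S0 : 0 <= S by rewrite sumr_ge0// => j _; exact: sqr_ge0.
have N20 : 0 <= N2 by rewrite sumr_ge0// => j _; exact: sqr_ge0.
have seta : s <= eta by rewrite (le_trans _ keta)// ler_peMl ?(ltW s_gt0)// ler1n.
have l2 : 0 < l ^+ 2 by rewrite exprn_gt0.
have N2l : `|N2 - l ^+ 2| <= eta + l ^+ 2 * eta + 2 * S * s.
  rewrite (_ : N2 - l ^+ 2 = (N2 - H) - (l ^+ 2 - H)); last by ring.
  apply: (le_trans (ler_normB _ _)); rewrite (@ger0_norm _ (l ^+ 2 - H)) ?subr_ge0//.
  have : H * s <= l ^+ 2 * eta.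
    rewrite ler_pM// ?(ltW s_gt0)// /H sumr_ge0// => j _; exact: sqr_ge0.
  by move: NH; rewrite mulrDl; lra.
have N2le : N2 <= 2 * l ^+ 2 + 2 * S * s.
  have : H * s <= l ^+ 2.
    by rewrite (le_trans _ Hl)// ler_piMr// /H sumr_ge0// => j _; exact: sqr_ge0.
  by have := ler_norm (N2 - H); move: NH; rewrite mulrDl; lra.
have li : 0 <= l^-1 by rewrite invr_ge0 ltW.
have Ss0 : 0 <= S * s by rewrite mulr_ge0// ltW.
have t1 : q * N2 / l <= 2 * l * eta + 2 / l * (S * s).
  have -> : 2 * l * eta + 2 / l * (S * s) = (eta * (2 * l ^+ 2) + 2 * S * s) / l.
    by field; rewrite lt0r_neq0.
  rewrite ler_wpM2r//.
  apply: (le_trans (ler_wpM2r N20 qeta)); apply: (le_trans (ler_wpM2l eta0 N2le)).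
  rewrite mulrDr lerD2l ler_piMl//.
  by rewrite -mulrA mulr_ge0.
have t2 : `|N2 - l ^+ 2| / l ^+ 2 <= eta / l ^+ 2 + eta + 2 / l ^+ 2 * (S * s).
  have -> : eta / l ^+ 2 + eta + 2 / l ^+ 2 * (S * s) =
      (eta + l ^+ 2 * eta + 2 * S * s) / l ^+ 2.
    by field; rewrite lt0r_neq0.
  by rewrite ler_wpM2r// invr_ge0 ltW.
have t3 : 3 * k%:R / (Num.sqrt n%:R * l) <= 3 / l * eta.
  have -> : 3 * k%:R / (Num.sqrt n%:R * l) = 3 / l * (k%:R * s).
    by rewrite /s; field; rewrite !lt0r_neq0.
  by rewrite ler_wpM2l// mulr_ge0.
have -> : (2 * l + 7 / l ^+ 2 + 21 + 3 / l) * eta / delta + 4 * delta +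
    (2 / l + 14 / l ^+ 2) * s / delta * S =
  ((2 * l * eta + 2 / l * (S * s)) + 7 * ((eta / l ^+ 2 + eta + 2 / l ^+ 2 * (S * s)) + 2 * eta)
    + 3 / l * eta) / delta + 4 * delta.
  by field; rewrite !lt0r_neq0.
rewrite lerD2r ler_wpM2r ?invr_ge0 ?(ltW d0)//.
rewrite lerD// lerD// ler_wpM2l// lerD// ler_wpM2l//.
Qed.

Section true_distribution.
Context d (Omega : measurableType d) (P : probability Omega R).
Variable xi : nat -> {RV P >-> R}.
Hypothesis xi_normal : forall j (B : set R), measurable B ->
  distribution P (xi j) B = normal_prob 0 1 B.

Lemma expectation_noise_sq_le j : (\int[P]_w (xi j w ^+ 2)%:E <= 6%:E)%E.
Proof.
have mxi : measurable_fun setT (xi j : Omega -> measurableTypeR R).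
  by move=> mD Y mY; exact: (measurable_funP (xi j)).
have msq : measurable_fun setT (fun x : measurableTypeR R => (x ^+ 2)%:E).
  by apply/measurable_EFinP; exact: measurable_funX.
apply: le_trans (normal_second_moment_le (R := R)).
have E := @ge0_integral_pushforward _ _ _ _ R _ mxi P setT _ measurableT msq
  (fun x _ => sqr_ge0 x).
suff <- : (\int[pushforward P (xi j : Omega -> measurableTypeR R)]_x (x ^+ 2)%:E =
    \int[gauss (0%R : R) 1%R]_x (x ^+ 2)%:E)%E by rewrite E.
apply: (@eq_measure_integral _ _ _ _ _
  (image_measure P mxi)) => A mA _.
exact: xi_normal.
Qed.

Lemma expected_bvm_error_le (tau delta eta : R) (r := tau / Num.sqrt (tau ^+ 2 + s ^+ 2)) :
  0 < tau -> 0 < delta -> 0 <= eta <= 1 -> H <= l ^+ 2 ->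
  l ^+ 2 - H <= eta -> Num.sqrt n%:R * (1 - r ^+ 2) <= eta -> k%:R * s <= eta ->
  (\int[P]_w bvm_error theta0 tau k n (xi ^~ w) <=
   ((2 * l + 91 / l ^+ 2 + 21 + 15 / l) * eta / delta + 4 * delta)%:E)%E.
Proof.
move=> tau0 d0 eta01 Hl Heta qeta keta; have /andP[eta0 eta1] := eta01.
pose S (w : Omega) := \sum_(j < k) xi j w ^+ 2.
have mS : measurable_fun setT S.
  apply: measurable_sum => j; apply: measurable_funX; exact: measurable_funP.
have S0 w : 0 <= S w by rewrite sumr_ge0// => j _; exact: sqr_ge0.
pose a := (2 * l + 7 / l ^+ 2 + 21 + 3 / l) * eta / delta + 4 * delta.
pose b := (2 / l + 14 / l ^+ 2) * s / delta.
have a0 : 0 <= a.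
  by rewrite addr_ge0 ?mulr_ge0 ?invr_ge0 ?addr_ge0 ?mulr_ge0 ?invr_ge0 ?sqr_ge0
    ?(ltW l_gt0) ?(ltW d0).
have b0 : 0 <= b.
  by rewrite !mulr_ge0 ?invr_ge0 ?addr_ge0 ?mulr_ge0 ?invr_ge0 ?sqr_ge0
    ?(ltW l_gt0) ?(ltW d0) ?(ltW s_gt0).
have S6 : (\int[P]_w (S w)%:E <= (6 * k%:R)%:E)%E.
  apply: (@integral_sum_sq_le _ _ _ P k (fun j => xi j)) => j.
    exact: measurable_funP.
  exact: expectation_noise_sq_le.
apply: (@le_trans _ _ (\int[P]_w (a + b * S w + 0 * S w)%R%:E)%E).
  apply: integral_monotone => w.
    exact: interval_dist_ge0.
  rewrite mul0r addr0; exact: bvm_error_le_noise.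
apply: (le_trans (integral_affine_le (mu := P) a0 b0 (lexx 0) mS mS S0 S0 S6 S6)).
rewrite lee_fin mul0r addr0 /a /b.
(* The noise sum has mean at most 6 k, and k s <= eta: 15 = 3 + 6 * 2 and 91 = 7 + 6 * 14. *)
have -> : (2 * l + 91 / l ^+ 2 + 21 + 15 / l) * eta / delta + 4 * delta =
    (2 * l + 7 / l ^+ 2 + 21 + 3 / l) * eta / delta + 4 * delta +
    (12 / l + 84 / l ^+ 2) / delta * eta by field; rewrite !lt0r_neq0.
have -> : (2 / l + 14 / l ^+ 2) * s / delta * (6 * k%:R) =
    (12 / l + 84 / l ^+ 2) / delta * (k%:R * s).
  by field; rewrite !lt0r_neq0// invr_gt0.
by rewrite lerD2l ler_wpM2l// mulr_ge0 ?addr_ge0 ?mulr_ge0 ?invr_ge0 ?sqr_ge0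
  ?(ltW l_gt0) ?(ltW d0).
Qed.

Hypothesis xi_indep : mutually_independent xi.

Lemma law_bvm_fluctuation_le (delta eta x : R) : 0 < delta ->
  `|H - l ^+ 2| <= eta -> k%:R * s <= eta ->
  (`|P [set w | (bvm_fluctuation theta0 k n (xi ^~ w) <= x)%R] -
     normal_prob 0 1 `]-oo, x]| <=
   ((7 / l ^+ 2 + 3 / l) * eta / delta + 4 * delta)%:E)%E.
Proof.
move=> d0 Heta keta.
pose y : V k := first_coords k theta0.
have yH : \sum_(j < k) tnth y j ^+ 2 = H.
  by apply: eq_bigr => j _; rewrite tnth_mktuple.
pose X (z : V k) : V k := [tuple s * tnth z j + 1 * tnth y j | j < k].
pose A := [set t : V k | scaled_sq_diff theta0 n (euclid_norm t) (euclid_norm y) \in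
  (`]-oo, x]%classic : set (measurableTypeR R))].
have mA : measurable A by apply: measurable_scaled_sq_diff; exact: measurable_itv.
have mXA : measurable (X @^-1` A).
  rewrite -[_ @^-1` _]setTI; exact: measurable_tuple_affine.
have obsE w : first_coords k (obs theta0 n (xi ^~ w)) = X [tuple xi j w | j < k].
  by apply: eq_from_tnth => j; rewrite !tnth_mktuple mul1r addrC.
have -> : P [set w | bvm_fluctuation theta0 k n (xi ^~ w) <= x] =
    gauss_vec k (X @^-1` A).
  rewrite -(law_iid_tuple xi_normal xi_indep mXA); congr (P _).
  apply/seteqP; split => w; rewrite /= inE /A /bvm_fluctuation obsE /= inE /= in_itv/=.
  - by [].
  - by [].
have r01 : 0 <= (1 : R) <= 1 by rewrite ler01 lexx.
have := gauss_vec_sq_diff y `]-oo, x] k_gt0 n_gt0 r01 l_gt0 d0.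
(* At shrinkage 1 the terms in q vanish. *)
rewrite yH expr1n subrr mulr0 !mul0r add0r mulr0 addr0 => E.
have -> : X @^-1` A = [set z : V k | Num.sqrt n%:R * (\sum_(j < k)
     (1 / Num.sqrt n%:R * tnth z j + 1 * tnth y j) ^+ 2 - H) / (2 * l) \in `]-oo, x]].
  have WE (z : V k) : Num.sqrt n%:R * (\sum_(j < k)
      (1 / Num.sqrt n%:R * tnth z j + 1 * tnth y j) ^+ 2 - H) / (2 * l) =
      scaled_sq_diff theta0 n (euclid_norm (X z)) (euclid_norm y).
    rewrite /scaled_sq_diff !sqr_euclid_norm yH; congr (_ * (_ - _) / _).
    by apply: eq_bigr => j _; rewrite [in RHS]tnth_mktuple div1r.
  by apply/seteqP; split => z /=; rewrite WE; [move/set_mem|move=> ?; exact: mem_set].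
apply: le_trans E _; rewrite lee_fin lerD2r ler_wpM2r ?invr_ge0 ?(ltW d0)//.
rewrite [leRHS]mulrDl; apply: lerD.
  rewrite (_ : 7 / l ^+ 2 * eta = 7 * (eta / l ^+ 2)); last by rewrite mulrAC mulrA.
  by rewrite ler_wpM2l// ler_wpM2r// invr_ge0 sqr_ge0.
have -> : 3 * k%:R / (Num.sqrt n%:R * l) = 3 / l * (k%:R * s).
  by rewrite /s; field; rewrite !lt0r_neq0.
by rewrite ler_wpM2l// divr_ge0// ltW.
Qed.

End true_distribution.
End fixed_sample_size.
End gaussian_sequence_bounds.

(** * Asymptotics *)

Section real_analysis.
Context {R : realType}.

Lemma cvge_fin_dist (u : nat -> \bar R) (l : R) :
  (forall e, 0 < e -> \forall n \near \oo, (`|u n - l%:E| <= e%:E)%E) ->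
  u n @[n --> \oo] --> l%:E.
Proof.
move=> ul.
have fin n e : (`|u n - l%:E| <= e%:E)%E -> u n \is a fin_num.
  by case: (u n).
apply/fine_cvgP; split.
  by have := ul 1 ltr01; apply: filterS => n; exact: fin.
apply/cvgrPdist_le => e e0; have := ul e e0; apply: filterS => n h.
have := h; rewrite -(fineK (fin _ _ h)) -EFinB => h'.
by rewrite distrC; exact: h'.
Qed.

Lemma sqrt_nat_ge1 n : (0 < n)%N -> 1 <= Num.sqrt n%:R :> R.
Proof. by move=> n0; rewrite -[leLHS]sqrtr1 ler_wsqrtr// ler1n. Qed.

(** * Tails of Sobolev sequences *)

Section sobolev_tail.
Variables (alpha : R) (u : nat -> R).
Hypotheses (alpha_gt0 : 0 < alpha) (u_sobolev : sobolev alpha u).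
Let w j := `|u j| ^+ 2 * (j.+1)%:R `^ (2 * alpha).

Let sq_le_w j : u j ^+ 2 <= w j.
Proof.
rewrite /w real_normK ?num_real// ler_peMr ?sqr_ge0//.
by rewrite -[leLHS](powRr0 j.+1%:R) ler_powR ?ler1n// mulr_ge0// ltW.
Qed.

Let w_ge0 j : 0 <= w j.
Proof. exact: le_trans (sqr_ge0 _) (sq_le_w j). Qed.

Let cvg_sq : cvgn [series u j ^+ 2]_j.
Proof. by apply: (series_le_cvg _ w_ge0 sq_le_w u_sobolev) => j; exact: sqr_ge0. Qed.

Let nd_sq : nondecreasing_seq [series u j ^+ 2]_j.
Proof. by apply: nondecreasing_series => j _ _; exact: sqr_ge0. Qed.

Let partial_sum k : \sum_(j < k) u j ^+ 2 = [series u j ^+ 2]_j k.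
Proof. by rewrite /series /= big_mkord. Qed.

Lemma sum_sq_le_l2_norm k : \sum_(j < k) u j ^+ 2 <= l2_norm u ^+ 2.
Proof.
rewrite partial_sum /l2_norm sqr_sqrtr; first exact: nondecreasing_cvgn_le.
by apply: le_trans (nondecreasing_cvgn_le nd_sq cvg_sq 0); rewrite /series /= big_geq.
Qed.

Lemma l2_norm_gt0 : u <> (fun=> 0) -> 0 < l2_norm u.
Proof.
move=> u0; have [j uj] : exists j, u j != 0.
  apply: contrapT => /forallNP h; apply: u0; apply/funext => j.
  by apply/eqP; have /negP := h j; rewrite negbK.
have : 0 < l2_norm u ^+ 2.
  apply: lt_le_trans (sum_sq_le_l2_norm j.+1); rewrite big_ord_recr/=.
  by rewrite ltr_wpDl ?sumr_ge0// => [i _|]; rewrite ?sqr_ge0// exprn_even_gt0.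
move=> l2; rewrite lt_def sqrtr_ge0 andbT; apply: contraTneq l2 => ->.
by rewrite expr0n ltxx.
Qed.

(** Beyond the first [k] coordinates the Sobolev weight (j + 1)^(2 alpha) is at least k^(2 alpha),
    so [M] can be the full weighted sum. *)
Lemma l2_norm_tail_le : exists2 M, 0 <= M &
  forall k, (0 < k)%N ->
    l2_norm u ^+ 2 - \sum_(j < k) u j ^+ 2 <= M / k%:R `^ (2 * alpha).
Proof.
have nd_w : nondecreasing_seq (series w) by apply: nondecreasing_series.
have w_le m : series w m <= limn (series w) by exact: nondecreasing_cvgn_le.
exists (limn (series w)).
  by apply: le_trans (w_le 0); rewrite /series /= big_geq.
move=> k k0; rewrite lerBlDr /l2_norm sqr_sqrtr; last first.
  by apply: le_trans (nondecreasing_cvgn_le nd_sq cvg_sq 0); rewrite /series /= big_geq.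
set K := k%:R `^ _; have K0 : 0 < K by rewrite powR_gt0// ltr0n.
apply: limr_le => //; exists k => // m /= km.
rewrite /series /= (@big_cat_nat _ _ _ k)//= big_mkord addrC lerD2r.
rewrite ler_pdivlMr// mulrC mulr_sumr.
apply: le_trans (w_le m); rewrite /series /= (@big_cat_nat _ _ _ k 0 m)//=.
rewrite -[leLHS]add0r lerD ?sumr_ge0// !big_nat; apply: ler_sum => j /andP[kj _].
rewrite /w real_normK ?num_real// mulrC ler_wpM2l ?sqr_ge0//.
by rewrite ge0_ler_powR ?nnegrE ?mulr_ge0 ?(ltW alpha_gt0)// ler_nat ltnW.
Qed.

End sobolev_tail.

(** * Consequences of the growth conditions *)

Section growth_conditions.
Variables (alpha : R) (theta0 : nat -> R) (tau : nat -> R) (k : nat -> nat).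
Hypotheses (alpha_gt : 2^-1 < alpha) (theta0_neq0 : theta0 <> (fun=> 0)).
Hypothesis theta0_sobolev : sobolev alpha theta0.
Hypothesis tau_gt0 : forall n, (1 <= n)%N -> 0 < tau n.
Hypothesis tau_large : (fun n : nat => n%:R `^ (- 4^-1)) =o_\oo tau.
Hypothesis k_small : (fun n : nat => (k n)%:R : R) =o_\oo (fun n : nat => Num.sqrt n%:R : R).
Hypothesis k_large : (fun n : nat => Num.sqrt n%:R)
  =o_\oo (fun n : nat => (k n)%:R `^ (2 * alpha)).
Let s n : R := (Num.sqrt n%:R)^-1.
Let H n := \sum_(j < k n) theta0 j ^+ 2.
Let l := l2_norm theta0.

Let alpha_gt0 : 0 < alpha.
Proof. by apply: lt_trans alpha_gt; rewrite invr_gt0. Qed.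

Lemma dim_negligible eta : 0 < eta -> \forall n \near \oo, (k n)%:R * s n <= eta.
Proof.
move=> eta0; have := k_small => /eqoP /(_ _ eta0) h; near=> n.
have n0 : (0 < n)%N by near: n; exact: nbhs_infty_gt.
have sq0 : 0 < Num.sqrt n%:R :> R by rewrite sqrtr_gt0 ltr0n.
rewrite /s ler_pdivrMr//.
have : `|(k n)%:R : R| <= eta * `|Num.sqrt n%:R : R| by near: n; exact: h.
by rewrite normr_nat ger0_norm ?(ltW sq0).
Unshelve. all: by end_near. Qed.

(** A zero dimension would make k^(2 alpha) vanish while sqrt n > 0. Deducing positivity from growth
    also covers the adaptive dimension, which is 0 at n = 1. *)
Lemma dim_gt0_near : \forall n \near \oo, (0 < k n)%N.
Proof.
have := k_large => /eqoP /(_ _ ltr01) h; near=> n.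
have n0 : (0 < n)%N by near: n; exact: nbhs_infty_gt.
have sq0 : 0 < Num.sqrt n%:R :> R by rewrite sqrtr_gt0 ltr0n.
have : `|Num.sqrt n%:R : R| <= 1 * `|(k n)%:R `^ (2 * alpha)| by near: n; exact: h.
rewrite lt0n; apply: contraTneq => ->.
by rewrite powR0 ?mulf_neq0 ?gt_eqF// normr0 mulr0 -ltNge normr_gt0 gt_eqF.
Unshelve. all: by end_near. Qed.

(** Serves twice: divided by 2 l this is the size of the bias, and since sqrt n >= 1 it dominates
    the tail in the error bounds. *)
Lemma tail_negligible eta : 0 < eta ->
  \forall n \near \oo, Num.sqrt n%:R * (l ^+ 2 - H n) <= eta.
Proof.
move=> eta0; have [M M0 tail] := l2_norm_tail_le alpha_gt0 theta0_sobolev.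
(* Only [0 <= M] is known, hence the denominator [M + 1]. *)
have e0 : 0 < eta / (M + 1) by rewrite divr_gt0// ltr_wpDl.
have := k_large => /eqoP /(_ _ e0) h; near=> n.
have kn0 : (0 < k n)%N by near: n; exact: dim_gt0_near.
have K0 : 0 < (k n)%:R `^ (2 * alpha) :> R by rewrite powR_gt0// ltr0n.
have : `|Num.sqrt n%:R : R| <= eta / (M + 1) * `|(k n)%:R `^ (2 * alpha)|.
  by near: n; exact: h.
rewrite ger0_norm ?sqrtr_ge0// (gtr0_norm K0) => sqn.
apply: (le_trans (ler_wpM2l (sqrtr_ge0 _) (tail _ kn0))).
rewrite mulrA ler_pdivrMr//; apply: (le_trans (ler_wpM2r M0 sqn)).
rewrite mulrAC ler_wpM2r ?(ltW K0)// mulrAC ler_pdivrMr ?ltr_wpDl//.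
by rewrite ler_wpM2l ?(ltW eta0)// lerDl.
Unshelve. all: by end_near. Qed.

(** Since 1 - r^2 = s^2 / (tau^2 + s^2), the left side is s / (tau^2 + s^2) <= s / tau^2. As s is
    the square of n^(-1/4), the hypothesis on [tau] is used with constant sqrt eta. *)
Lemma prior_negligible eta : 0 < eta ->
  \forall n \near \oo,
    Num.sqrt n%:R * (1 - (tau n / Num.sqrt (tau n ^+ 2 + s n ^+ 2)) ^+ 2) <= eta.
Proof.
move=> eta0; have e0 : 0 < Num.sqrt eta by rewrite sqrtr_gt0.
have := tau_large => /eqoP /(_ _ e0) h; near=> n.
have n0 : (0 < n)%N by near: n; exact: nbhs_infty_gt.
have sq0 : 0 < Num.sqrt n%:R :> R by rewrite sqrtr_gt0 ltr0n.
have s0 : 0 < s n by rewrite invr_gt0.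
have t0 : 0 < tau n by exact: tau_gt0.
have : `|n%:R `^ (- 4^-1) : R| <= Num.sqrt eta * `|tau n| by near: n; exact: h.
rewrite ger0_norm ?powR_ge0// (gtr0_norm t0) => pt.
have p2 : (n%:R `^ (- 4^-1)) ^+ 2 = s n.
  rewrite -powR_mulrn ?powR_ge0// -powRrM (_ : - 4^-1 * 2%:R = - 2^-1); last by field.
  by rewrite powRN powR12_sqrt.
have st : s n <= eta * tau n ^+ 2.
  rewrite -p2 -[X in X * _](@sqr_sqrtr _ eta) ?(ltW eta0)// -exprMn.
  by rewrite ler_pXn2r// nnegrE ?powR_ge0// mulr_ge0// ltW.
have c2 : 0 < tau n ^+ 2 + s n ^+ 2 by rewrite ltr_wpDl ?sqr_ge0 ?exprn_gt0.
rewrite expr_div_n sqr_sqrtr ?(ltW c2)//.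
have -> : 1 - tau n ^+ 2 / (tau n ^+ 2 + s n ^+ 2) = s n ^+ 2 / (tau n ^+ 2 + s n ^+ 2).
  by field; rewrite gt_eqF.
rewrite mulrA {1}/s expr2 mulrA mulfV ?gt_eqF// mul1r ler_pdivrMr//.
apply: (le_trans st); rewrite ler_wpM2l ?(ltW eta0)// lerDl sqr_ge0.
Unshelve. all: by end_near. Qed.

Lemma bvm_bias_negligible : (fun n : nat => bvm_bias theta0 (k n) n) =o_\oo (fun=> 1 : R).
Proof.
have l0 : 0 < l := l2_norm_gt0 alpha_gt0 theta0_sobolev theta0_neq0.
apply/eqoP => e e0; have el : 0 < 2 * l * e by rewrite !mulr_gt0.
have := tail_negligible el; apply: filterS => n h.
rewrite normr1 mulr1 /bvm_bias /scaled_sq_diff sqr_euclid_norm -/l.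
under eq_bigr do rewrite tnth_mktuple.
rewrite -/(H n) -opprB mulrN mulNr normrN ger0_norm.
  by rewrite ler_pdivrMr ?mulr_gt0// [leRHS]mulrC.
rewrite divr_ge0 ?mulr_ge0 ?sqrtr_ge0 ?(ltW l0)// subr_ge0.
exact: (sum_sq_le_l2_norm alpha_gt0 theta0_sobolev).
Qed.

Section true_distribution.
Context d (Omega : measurableType d) (P : probability Omega R).
Variable xi : nat -> {RV P >-> R}.
Hypothesis xi_normal : forall j (B : set R), measurable B ->
  distribution P (xi j) B = normal_prob 0 1 B.

Let noise_small eta : 0 < eta -> \forall n \near \oo,
  [/\ (0 < n)%N, (0 < k n)%N, l ^+ 2 - H n <= eta & (k n)%:R * s n <= eta].
Proof.
move=> eta0; near=> n.
have n0 : (0 < n)%N by near: n; exact: nbhs_infty_gt.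
split=> //; first by near: n; exact: dim_gt0_near.
- apply: (@le_trans _ _ (Num.sqrt n%:R * (l ^+ 2 - H n))).
    rewrite ler_peMl ?sqrt_nat_ge1// subr_ge0.
    exact: (sum_sq_le_l2_norm alpha_gt0 theta0_sobolev).
  by near: n; exact: tail_negligible.
- by near: n; exact: dim_negligible.
Unshelve. all: by end_near. Qed.

Lemma expected_bvm_error_cvg0 :
  (\int[P]_w bvm_error theta0 (tau n) (k n) n (xi ^~ w))%E @[n --> \oo] --> 0%E.
Proof.
have l0 : 0 < l := l2_norm_gt0 alpha_gt0 theta0_sobolev theta0_neq0.
apply: cvge_fin_dist => e e0.
(* Thus [4 * delta] is half of [e]; [eta] is then chosen to keep the other term below the second
   half, and at most 1 as the bound requires. *)
pose delta := e / 8; have d0 : 0 < delta by rewrite divr_gt0.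
pose K := 2 * l + 91 / l ^+ 2 + 21 + 15 / l.
have K0 : 0 < K.
  by rewrite !addr_gt0 ?divr_gt0 ?mulr_gt0 ?exprn_gt0.
pose eta := Num.min 1 (e / 2 * delta / K).
have eta0 : 0 < eta by rewrite lt_min ltr01 !mulr_gt0 ?invr_gt0.
have eta01 : 0 <= eta <= 1 by rewrite (ltW eta0) ge_min lexx.
near=> n.
have [n0 k0 Hn kn] :
    [/\ (0 < n)%N, (0 < k n)%N, l ^+ 2 - H n <= eta & (k n)%:R * s n <= eta].
  by near: n; exact: noise_small.
rewrite sube0 gee0_abs; last by apply: integral_ge0 => w _; exact: interval_dist_ge0.
apply: (le_trans (expected_bvm_error_le k0 n0 l0 xi_normal (tau_gt0 n0) d0 eta01 _ Hn _ kn)).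
- exact: (sum_sq_le_l2_norm alpha_gt0 theta0_sobolev).
- by near: n; exact: prior_negligible.
rewrite lee_fin -/K.
have : K * eta / delta <= e / 2.
  rewrite ler_pdivrMr// mulrC -ler_pdivlMr//.
  by rewrite /eta ge_min lexx orbT.
by rewrite /delta; lra.
Unshelve. all: by end_near. Qed.

Hypothesis xi_indep : mutually_independent xi.

Lemma bvm_fluctuation_cvg_in_distribution :
  cvg_in_distribution P (fun n w => bvm_fluctuation theta0 (k n) n (xi ^~ w))
    (normal_prob 0 1).
Proof.
have l0 : 0 < l := l2_norm_gt0 alpha_gt0 theta0_sobolev theta0_neq0.
move=> x _.
have fin : normal_prob 0 1 `]-oo, x]%classic \is a fin_num.
  by apply: (@fin_num_measure _ _ _ (gauss 0 1)); exact: measurable_itv.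
rewrite -(fineK fin); apply: cvge_fin_dist => e e0; rewrite (fineK fin).
pose delta := e / 8; have d0 : 0 < delta by rewrite divr_gt0.
pose K := 7 / l ^+ 2 + 3 / l.
have K0 : 0 < K by rewrite !addr_gt0 ?divr_gt0 ?exprn_gt0.
pose eta := e / 2 * delta / K.
have eta0 : 0 < eta by rewrite !mulr_gt0 ?invr_gt0.
near=> n.
have [n0 k0 Hn kn] :
    [/\ (0 < n)%N, (0 < k n)%N, l ^+ 2 - H n <= eta & (k n)%:R * s n <= eta].
  by near: n; exact: noise_small.
have Habs : `|H n - l ^+ 2| <= eta.
  rewrite distrC ger0_norm// subr_ge0.
  exact: (sum_sq_le_l2_norm alpha_gt0 theta0_sobolev).
apply: (le_trans (law_bvm_fluctuation_le k0 n0 l0 xi_normal xi_indep x d0 Habs kn)).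
rewrite lee_fin -/K.
have : K * eta / delta <= e / 2.
  by rewrite ler_pdivrMr// mulrC -ler_pdivlMr.
by rewrite /delta; lra.
Unshelve. all: by end_near. Qed.

End true_distribution.
End growth_conditions.
End real_analysis.

(** * The adaptive dimension *)

Section adaptive_dimension.
Context {R : realType}.

(** The cube of exp (x / 3) >= x / 3. A cubic bound suffices: after a division by L = ln n it is
    still quadratic, and has to beat a multiple of L. *)
Lemma expR_ge_cube (x : R) : 0 <= x -> x ^+ 3 / 27 <= expR x.
Proof.
move=> x0; have -> : x ^+ 3 / 27 = (x / 3) ^+ 3 by field.
have -> : expR x = expR (x / 3) ^+ 3.
  by rewrite -expRM_natl; congr expR; field.
rewrite ler_pXn2r ?nnegrE ?expR_ge0 ?divr_ge0//.
by apply: le_trans (expR_ge1Dx _); rewrite lerDr.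
Qed.

Lemma ln_nat_near_ge (A : R) : \forall n \near \oo, A <= ln n%:R.
Proof.
near=> n; have nA : expR A <= n%:R by near: n; exact: nbhs_infty_ger.
rewrite -ler_expR lnK// posrE; exact: lt_le_trans (expR_gt0 _) nA.
Unshelve. all: by end_near. Qed.

Lemma adaptive_dim_small :
  (fun n : nat => (adaptive_dim R n)%:R : R) =o_\oo (fun n : nat => Num.sqrt n%:R : R).
Proof.
apply/eqoP => e e0; near=> n.
have L : (e ^+ 2)^-1 <= ln n%:R :> R by near: n; exact: ln_nat_near_ge.
have L0 : 0 < ln n%:R :> R by apply: lt_le_trans L; rewrite invr_gt0 exprn_gt0.
rewrite normr_nat ger0_norm ?sqrtr_ge0//.
apply: (@le_trans _ _ (Num.sqrt (n%:R / ln n%:R))).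
  by rewrite truncn_le sqrtr_ge0.
rewrite -(gtr0_norm e0) -sqrtr_sqr -sqrtrM ?sqr_ge0// ler_wsqrtr// mulrC.
by rewrite ler_wpM2r// -[leRHS]invrK lef_pV2// posrE invr_gt0 exprn_gt0.
Unshelve. all: by end_near. Qed.

(* With [L = ln n] and [y = n / L], the claim reduces to [L <= c^2 y^(a - 1)],
   where [y^b >= exp (b L) / L] for every [b <= 1]. *)
Lemma adaptive_dim_large (a : R) : 1 < a ->
  (fun n : nat => Num.sqrt n%:R : R) =o_\oo (fun n : nat => (adaptive_dim R n)%:R `^ a).
Proof.
move=> a1; apply/eqoP => e e0.
have two_a : 0 < (2 : R) `^ a by exact: powR_gt0.
(* The factor 2^a pays for bounding the truncated dimension below by x / 2. *)
pose c := e / 2 `^ a; have c0 : 0 < c by rewrite divr_gt0.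
(* [b <= 1] gives L^b <= L, and [b <= a - 1] gives y^b <= y^(a - 1). *)
pose b := Num.min 1 (a - 1).
have b0 : 0 < b by rewrite lt_min ltr01 subr_gt0.
near=> n.
(* As 11^2 >= 108, exp L >= L^3 / 27 >= 4 L; hence y >= 4 and x >= 2, and truncation loses at most
   half of x. The next bound on L turns b^3 L^2 / 27 into at least L / c^2. *)
have L11 : 11 <= ln n%:R :> R by near: n; exact: ln_nat_near_ge.
have Lb : 27 / (c ^+ 2 * b ^+ 3) <= ln n%:R :> R by near: n; exact: ln_nat_near_ge.
have n0 : (0 < n)%N by near: n; exact: nbhs_infty_gt.
set L := ln n%:R in L11 Lb *.
have nE : n%:R = expR L by rewrite lnK// posrE ltr0n.
have L0 : 0 < L by lra.
have y4 : 4 <= n%:R / L.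
  rewrite ler_pdivlMr// nE; apply: le_trans (expR_ge_cube (ltW L0)).
  by rewrite ler_pdivlMr//; nra.
set y := n%:R / L in y4.
have y0 : 0 < y by lra.
pose x := Num.sqrt y.
have x2 : 2 <= x.
  by rewrite (_ : 2 = Num.sqrt (2 ^+ 2)) ?ler_wsqrtr ?sqrtr_sqr ?normr_nat//; lra.
have xy : x * x = y by rewrite -expr2 sqr_sqrtr// ltW.
have k_ge : x / 2 <= (adaptive_dim R n)%:R.
  have : x < (adaptive_dim R n).+1%:R by exact: truncnS_gt.
  by rewrite -natr1; lra.
have yb : b ^+ 3 * L ^+ 2 / 27 <= y `^ (a - 1).
  apply: (@le_trans _ _ (y `^ b)); last first.
    by rewrite ler_powR ?(le_trans _ y4)// ?ler1n// /b ge_min lexx orbT.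
  have nb : expR (b * L) = y `^ b * L `^ b.
    by rewrite -powRM ?(ltW y0) ?(ltW L0)// /y divfK ?gt_eqF// nE -expRM mulrC.
  have LbL : L `^ b <= L.
    by rewrite -[leRHS](powRr1 (ltW L0)) ler_powR ?(le_trans _ L11) ?ler1n// /b ge_min lexx.
  rewrite -(ler_pM2r L0).
  apply: le_trans (ler_wpM2l (powR_ge0 y b) LbL); rewrite -nb.
  apply: le_trans (expR_ge_cube (mulr_ge0 (ltW b0) (ltW L0))).
  by rewrite le_eqVlt; apply/orP; left; apply/eqP; field.
have Lc : L <= c ^+ 2 * y `^ (a - 1).
  apply: le_trans (ler_wpM2l (sqr_ge0 c) yb).
  move: Lb; rewrite ler_pdivrMr ?mulr_gt0 ?exprn_gt0// => Lb.
  rewrite mulrA ler_pdivlMr// [leRHS](_ : _ = L * (L * (c ^+ 2 * b ^+ 3))); last by ring.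
  by rewrite ler_wpM2l ?(ltW L0).
rewrite ger0_norm ?sqrtr_ge0// ger0_norm ?powR_ge0//.
apply: (@le_trans _ _ (e * (x / 2) `^ a)); last first.
  rewrite ler_wpM2l ?(ltW e0)// ge0_ler_powR ?nnegrE ?divr_ge0 ?ler0n//; lra.
have -> : e * (x / 2) `^ a = x * (c * x `^ (a - 1)).
  have xa : x `^ a = (x / 2) `^ a * 2 `^ a.
    by rewrite -powRM ?divr_ge0 ?sqrtr_ge0// divfK.
  rewrite mulrCA mulr_powRB1 ?sqrtr_ge0 ?(lt_trans _ a1)// xa /c.
  by field; rewrite gt_eqF.
have -> : Num.sqrt n%:R = x * Num.sqrt L :> R.
  rewrite /x -sqrtrM ?(ltW y0)// /y divfK// gt_eqF//.
rewrite ler_wpM2l ?sqrtr_ge0//.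
have cx0 : 0 <= c * x `^ (a - 1) by rewrite mulr_ge0 ?powR_ge0 ?(ltW c0).
rewrite -(ger0_norm cx0) -sqrtr_sqr ler_wsqrtr//.
rewrite exprMn [_ `^ _ ^+ 2]expr2 -powRM ?sqrtr_ge0//.
by rewrite xy.
Unshelve. all: by end_near. Qed.

End adaptive_dimension.

Theorem proposition3 (R : realType) (d : measure_display)
    (Omega : measurableType d) (P : probability Omega R)
    (xi : nat -> {RV P >-> R})
    (xi_normal : forall j (B : set R), measurable B ->
       distribution P (xi j) B = normal_prob 0 1 B)
    (xi_indep : mutually_independent xi) :
  (forall (alpha : R) (theta0 : nat -> R) (tau : nat -> R) (k : nat -> nat),
     2^-1 < alpha ->
     theta0 <> (fun=> 0) ->
     sobolev alpha theta0 ->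
     (forall n, (1 <= n)%N -> 0 < tau n) ->
     (fun n : nat => n%:R `^ (- 4^-1)) =o_\oo tau ->
     (forall n, (1 <= n)%N -> (1 <= k n <= n)%N) ->
     (fun n : nat => (k n)%:R : R) =o_\oo (fun n : nat => Num.sqrt n%:R : R) ->
     (fun n : nat => Num.sqrt n%:R)
       =o_\oo (fun n : nat => (k n)%:R `^ (2 * alpha)) ->
     [/\ (\int[P]_w bvm_error theta0 (tau n) (k n) n (xi ^~ w))%E
            @[n --> \oo] --> 0%E,
         cvg_in_distribution P
           (fun n w => bvm_fluctuation theta0 (k n) n (xi ^~ w))
           (normal_prob 0 1)
       & (fun n : nat => bvm_bias theta0 (k n) n) =o_\oo (fun=> 1 : R)])
  /\
  (forall alpha : R, 2^-1 < alpha ->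
     (fun n : nat => (adaptive_dim R n)%:R : R)
       =o_\oo (fun n : nat => Num.sqrt n%:R : R) /\
     (fun n : nat => Num.sqrt n%:R)
       =o_\oo (fun n : nat => (adaptive_dim R n)%:R `^ (2 * alpha)))
  /\
  (forall (alpha : R) (theta0 : nat -> R) (tau : nat -> R),
     2^-1 < alpha ->
     theta0 <> (fun=> 0) ->
     sobolev alpha theta0 ->
     (forall n, (1 <= n)%N -> 0 < tau n) ->
     (fun n : nat => n%:R `^ (- 4^-1)) =o_\oo tau ->
     [/\ (\int[P]_w bvm_error theta0 (tau n) (adaptive_dim R n) n (xi ^~ w))%E
            @[n --> \oo] --> 0%E,
         cvg_in_distribution P
           (fun n w => bvm_fluctuation theta0 (adaptive_dim R n) n (xi ^~ w))
           (normal_prob 0 1)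
       & (fun n : nat => bvm_bias theta0 (adaptive_dim R n) n)
           =o_\oo (fun=> 1 : R)]).
Proof.
have k_adaptive (alpha : R) : 2^-1 < alpha ->
    (fun n : nat => (adaptive_dim R n)%:R : R) =o_\oo (fun n : nat => Num.sqrt n%:R : R) /\
    (fun n : nat => Num.sqrt n%:R) =o_\oo (fun n : nat => (adaptive_dim R n)%:R `^ (2 * alpha)).
  move=> alpha_gt; split; first exact: adaptive_dim_small.
  (* The threshold alpha > 1/2 is exactly the condition that the exponent 2 alpha exceed 1. *)
  by apply: adaptive_dim_large; lra.
split; [|split=> //].
  move=> alpha theta0 tau k alpha_gt theta0_neq0 theta0_sob tau_gt0 tau_large _ k_small k_large.
  split.
  - exact: (expected_bvm_error_cvg0 alpha_gt).
  - exact: (bvm_fluctuation_cvg_in_distribution alpha_gt).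
  - exact: (bvm_bias_negligible alpha_gt).
move=> alpha theta0 tau alpha_gt theta0_neq0 theta0_sob tau_gt0 tau_large.
have [k_small k_large] := k_adaptive _ alpha_gt.
split.
- exact: (expected_bvm_error_cvg0 alpha_gt).
- exact: (bvm_fluctuation_cvg_in_distribution alpha_gt).
- exact: (bvm_bias_negligible alpha_gt).
Qed.
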